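(* Let $R>0$, $c\ge 0$, $k\ge 1$, and $f(x)=\frac{c}{2}|x|^2$ on $\mathbb{R}^{2+k}$. Let $\Sigma^2\subset\overline{\mathbb{B}_R^{2+k}}$ be a smooth compact connected orientable free boundary $f$-minimal surface with $\partial\Sigma\neq\emptyset$. If $$|A|^2\le \frac{1}{R^2}\qquad\text{on }\Sigma,$$ then $\Sigma$ is homeomorphic to the (closed two-dimensional) disk $D^2$.
   Context: $\mathbb{B}_R^{2+k}$ is the open Euclidean ball of radius $R$ centered at the origin of $\mathbb{R}^{2+k}$, and $x$ is the position vector. $\bar\nabla$, $\nabla$ are the Euclidean connection and the Levi-Civita connection of $\Sigma$. The second fundamental form is $A(X,Y)=\bar\nabla_XY-\nabla_XY$, with $|A|^2=\sum_{i,j=1}^2|A(e_i,e_j)|^2$ for an orthonormal tangent frame; the (non-normalized) mean curvature vector is $\vec H=A(e_1,e_1)+A(e_2,e_2)$. $f$-minimal means $\vec H+(\bar\nabla f)^\perp=0$ on $\Sigma$, where $\perp$ denotes the normal component; for $f(x)=\frac c2|x|^2$ this is $\vec H=-c\,x^\perp$. Free boundary means $\partial \Sigma\subset\partial\mathbb{B}_R^{2+k}$, $\operatorname{Int}(\Sigma)\subset \mathbb{B}_R^{2+k}$, and $\Sigma$ meets $\partial \mathbb{B}_R^{2+k}$ orthogonally along $\partial \Sigma$. *)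

(* Defs.v *)
From HB Require Import structures.
From mathcomp Require Import all_boot all_order all_algebra.
From mathcomp Require Import all_classical all_reals all_analysis.

Set Implicit Arguments.
Unset Strict Implicit.
Unset Printing Implicit Defensive.

Import Order.TTheory GRing.Theory Num.Theory.
Import numFieldNormedType.Exports.

Local Open Scope classical_set_scope.
Local Open Scope ring_scope.

(* The library norm on ['rV[R]_n] is the sup norm, so Euclidean lengths are
   taken from [dotv]; topology and differentiability agree for both norms. *)
Section Euclidean.
Context {R : realType} {n : nat}.

Definition dotv (v w : 'rV[R]_n) : R := \sum_(i < n) v 0 i * w 0 i.

Definition enorm (v : 'rV[R]_n) : R := Num.sqrt (dotv v v).

Definition open_eball (r : R) : set 'rV[R]_n := [set v | enorm v < r].
Definition closed_eball (r : R) : set 'rV[R]_n := [set v | enorm v <= r].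
Definition esphere (r : R) : set 'rV[R]_n := [set v | enorm v = r].

Definition partial {V : normedModType R} (i : 'I_n) (g : 'rV[R]_n -> V) :
  'rV[R]_n -> V := fun u => 'D_(delta_mx 0 i) g u.

Definition grad (f : 'rV[R]_n -> R) (u : 'rV[R]_n) : 'rV[R]_n :=
  \row_(i < n) partial i (f : 'rV[R]_n -> R^o) u.

Fixpoint Cdiff {V : normedModType R} (m : nat) (W : set 'rV[R]_n)
    (g : 'rV[R]_n -> V) : Prop :=
  if m is m'.+1 then
    (forall u, W u -> differentiable g u) /\
    (forall i, Cdiff m' W (partial i g))
  else forall u, W u -> {for u, continuous g}.

(* C^oo on an open set [W] *)
Definition smooth_on {V : normedModType R} (W : set 'rV[R]_n)
    (g : 'rV[R]_n -> V) : Prop := forall m, Cdiff m W g.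

End Euclidean.

Section Homeomorphism.
Context {S T : topologicalType}.

Definition mutually_inverse_homeo (A : set S) (B : set T)
    (f : S -> T) (g : T -> S) : Prop :=
  [/\ (forall a, A a -> B (f a) /\ g (f a) = a),
      (forall b, B b -> A (g b) /\ f (g b) = b),
      {within A, continuous f} & {within B, continuous g}].

Definition homeomorphic (A : set S) (B : set T) : Prop :=
  exists f g, mutually_inverse_homeo A B f g.

End Homeomorphism.

Definition half_plane {R : realType} : set 'rV[R]_2 := [set u | 0 <= u 0 1].

(* A surface with boundary in R^n is a topological space [S] together with a
   position map [x : S -> R^n] that is locally a smooth regular parametrization
   over a relatively open subset of the closed half plane.  The smooth
   structure of [S] is the one that makes [x] an immersion: transition maps
   between the charts below are automatically smooth, since [x] is a smooth
   immersion in each of them.  An embedded surface is the case where [S] is a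
   subset of R^n and [x] the inclusion. *)
Section Surface.
Context {R : realType} {n : nat} {S : topologicalType}.
Implicit Types (x : S -> 'rV[R]_n).

(* The chart is [par : cdom `&` half_plane -> crng] with inverse [coord].
   Smoothness of [x \o par] up to the boundary line is expressed, as usual, by
   a smooth extension [ext] to an open subset of the plane; the derivatives of
   [ext] at points of the half plane depend only on [x \o par]. *)
Record chart x := Chart {
  cdom : set 'rV[R]_2;
  crng : set S;
  par : 'rV[R]_2 -> S;
  coord : S -> 'rV[R]_2;
  ext : 'rV[R]_2 -> 'rV[R]_n;
  cdom_open : open cdom;
  crng_open : open crng;
  chart_homeo : mutually_inverse_homeo (cdom `&` half_plane) crng par coord;
  ext_smooth : smooth_on cdom ext;
  extE : forall u, (cdom `&` half_plane) u -> ext u = x (par u);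
  ext_immersion : forall u, (cdom `&` half_plane) u -> row_free ('J ext u)
}.

Definition smooth_surface x : Prop :=
  hausdorff_space S /\ forall p : S, exists phi : chart x, crng phi p.

Definition bdry x : set S :=
  [set p | exists phi : chart x, crng phi p /\ coord phi p 0 1 = 0].

Definition int_surface x : set S := ~` bdry x.

Section AtPoint.
Context {x : S -> 'rV[R]_n} (phi : chart x) (u : 'rV[R]_2).

(* Tangent vectors of the surface are given by their coordinates
   [xi : 'rV[R]_2]; the vector of R^n they represent is [push xi]. *)
Definition push (xi : 'rV[R]_2) : 'rV[R]_n := xi *m 'J (ext phi) u.

Definition metric (w : 'rV[R]_2) : 'M[R]_2 :=
  \matrix_(i, j) dotv (partial i (ext phi) w) (partial j (ext phi) w).

Definition dmetric (l i j : 'I_2) : R :=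
  partial l ((fun w => metric w i j) : 'rV[R]_2 -> R^o) u.

(* Christoffel symbols Gamma^l_ij of the Levi-Civita connection *)
Definition christoffel (l i j : 'I_2) : R :=
  2^-1 * \sum_(m < 2) invmx (metric u) l m *
                      (dmetric i j m + dmetric j i m - dmetric m i j).

(* Ambient minus Levi-Civita derivative of the coordinate field d_j along d_i *)
Definition sff_coord (i j : 'I_2) : 'rV[R]_n :=
  partial i (partial j (ext phi)) u -
  \sum_(l < 2) christoffel l i j *: partial l (ext phi) u.

Definition sff (xi eta : 'rV[R]_2) : 'rV[R]_n :=
  \sum_(i < 2) \sum_(j < 2) (xi 0 i * eta 0 j) *: sff_coord i j.

(* The rows of [e] are the coordinates of the frame e_1, e_2. *)
Definition orthonormal_frame (e : 'M[R]_2) : Prop :=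
  forall i j : 'I_2, dotv (push (row i e)) (push (row j e)) = (i == j)%:R.

(* The three quantities below are meant for an orthonormal frame [e], and are
   then independent of [e]. *)
Definition sff_normsq (e : 'M[R]_2) : R :=
  \sum_(i < 2) \sum_(j < 2) enorm (sff (row i e) (row j e)) ^+ 2.

Definition mean_curvature (e : 'M[R]_2) : 'rV[R]_n :=
  \sum_(i < 2) sff (row i e) (row i e).

Definition normal_part (e : 'M[R]_2) (v : 'rV[R]_n) : 'rV[R]_n :=
  v - \sum_(i < 2) dotv v (push (row i e)) *: push (row i e).

End AtPoint.

Definition f_minimal (f : 'rV[R]_n -> R) x : Prop :=
  forall (phi : chart x) (u : 'rV[R]_2) (e : 'M[R]_2),
    (cdom phi `&` half_plane) u -> orthonormal_frame phi u e ->
    mean_curvature phi u e +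
      normal_part phi u e (grad f (x (par phi u))) = 0.

Definition sff_normsq_le x (b : R) : Prop :=
  forall (phi : chart x) (u : 'rV[R]_2) (e : 'M[R]_2),
    (cdom phi `&` half_plane) u -> orthonormal_frame phi u e ->
    sff_normsq phi u e <= b.

(* Conormal directions of the boundary, i.e. tangent vectors [push eta] of the
   surface that are orthogonal to the boundary curve (the first coordinate
   line of a chart), are orthogonal to the tangent hyperplane of the sphere. *)
Definition meets_sphere_orthogonally x : Prop :=
  forall (phi : chart x) (u : 'rV[R]_2),
    (cdom phi `&` half_plane) u -> u 0 1 = 0 ->
    forall eta : 'rV[R]_2,
      dotv (push phi u eta) (push phi u (delta_mx 0 0)) = 0 ->
      forall w : 'rV[R]_n, dotv w (x (par phi u)) = 0 ->
        dotv (push phi u eta) w = 0.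

Definition free_boundary (r : R) x : Prop :=
  [/\ x @` bdry x `<=` esphere r,
      x @` int_surface x `<=` open_eball r
    & meets_sphere_orthogonally x].

(* The matrix [M] is the (transposed) Jacobian matrix of the transition map
   from [phi] to [psi] at [p]. *)
Definition same_orientation x (phi psi : chart x) (p : S) : Prop :=
  exists M : 'M[R]_2,
    'J (ext phi) (coord phi p) = M *m 'J (ext psi) (coord psi p) /\
    0 < \det M.

Definition orientable x : Prop :=
  exists atlas : set (chart x),
    (forall p, exists2 phi, atlas phi & crng phi p) /\
    (forall phi psi p, atlas phi -> atlas psi -> crng phi p -> crng psi p ->
       same_orientation phi psi p).

End Surface.

(* Main.v *)
Require Import Defs.
From HB Require Import structures.
From mathcomp Require Import all_boot all_order all_algebra.
From mathcomp Require Import all_classical all_reals all_analysis.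
From mathcomp Require Import ring lra.

Set Implicit Arguments.
Unset Strict Implicit.
Unset Printing Implicit Defensive.

Import Order.TTheory GRing.Theory Num.Theory.
Import numFieldNormedType.Exports.

Local Open Scope classical_set_scope.
Local Open Scope ring_scope.

(** The theorem holds because the squared distance [phi = |x|^2] to the centre of
    the ball is a Morse function on the surface whose only critical points are
    nondegenerate minima, and whose top level is the boundary.

    On tangent vectors the Hessian of [phi / 2] is [|v|^2 + <A(v,v), x>].  The
    bound [|A| <= 1 / r] gives [|<A(v,v), x>| <= |v|^2 |x| / r], and [|x| < r] in
    the interior, so the Hessian is positive definite at every interior critical
    point ([half_hess_lower_bound]).  Only critical points matter: there [x] is
    normal and the Christoffel symbols do not contribute.  Along the boundary
    [phi] takes its maximum [r^2], and since the surface meets the sphere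
    orthogonally the conormal is parallel to [x], so [phi] strictly decreases
    inwards ([boundary_slope]).

    It remains to prove that a compact connected surface with such a function is
    a disk ([sublevel_disk]).  Near a global minimum a sublevel set is a disk,
    because [phi] increases along rays in a chart ([growth_centre]).  One then
    follows the component of this disk through the sublevel sets [{phi <= t}].
    The level [T] being the supremum of those where the sublevel set has a
    component homeomorphic to a disk, the property passes to [T]
    ([disk_part_limit]) and beyond it ([disk_part_extend]), so it holds for the
    whole surface.  Other minima can only create new components: a minimum at
    level [T] is an isolated point of [{phi <= T}], whereas a disk has no isolated
    point.

    The passage between nearby noncritical levels does not integrate the gradient
    flow.  Near a noncritical point there is a box in which [phi] increases along
    vertical lines; if a level function [G] is increased inside one such box, then
    [{phi <= G}] is carried to the new sublevel set by stretching the vertical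
    lines ([box_push]).  This works as long as [phi - G] still increases vertically,
    and this is guaranteed in all boxes at once when [G] is locally Lipschitz with
    a small constant with respect to the position map [x].  Finitely many boxes
    and bump functions of the distance [|x - x q|] lift one level to the next
    ([push_chain], [slab_homeo]). *)

(** * Homeomorphisms of compact sets *)

Lemma within_continuousP {S T : topologicalType} (A : set S) (f : S -> T) :
  {within A, continuous f} <->
  (forall s, A s -> forall V, nbhs (f s) V -> \forall s' \near s, A s' -> V (f s')).
Proof.
split=> [/subspace_continuousP cf s As V fsV|cf]; first exact: (cf s As V fsV).
by apply/subspace_continuousP => s As V fsV; apply: cf.
Qed.

Section CompactTopology.
Context {S T U : topologicalType}.

Lemma homeomorphic_sym (A : set S) (B : set T) :
  homeomorphic A B -> homeomorphic B A.
Proof. by move=> [f [g [fP gP cf cg]]]; exists g, f; split. Qed.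

Lemma homeomorphic_trans (A : set S) (B : set T) (C : set U) :
  homeomorphic A B -> homeomorphic B C -> homeomorphic A C.
Proof.
move=> [f [g [fP gP /within_continuousP cf /within_continuousP cg]]].
move=> [f' [g' [fP' gP' /within_continuousP cf' /within_continuousP cg']]].
exists (f' \o f), (g \o g'); split.
- move=> a Aa /=; have [Bfa gfa] := fP a Aa; have [Cfa ->] := fP' _ Bfa.
  by rewrite gfa.
- move=> c Cc /=; have [Bgc fgc] := gP' c Cc; have [Agc ->] := gP _ Bgc.
  by rewrite fgc.
- apply/within_continuousP => a Aa V ffV; have [Bfa _] := fP a Aa.
  have := cf a Aa _ (cf' _ Bfa _ ffV); apply: filterS => a' /= + Aa'.
  by apply=> //; case: (fP _ Aa').
- apply/within_continuousP => c Cc V ffV; have [Bgc _] := gP' c Cc.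
  have := cg' c Cc _ (cg _ Bgc _ ffV); apply: filterS => c' /= + Cc'.
  by apply=> //; case: (gP' _ Cc').
Qed.

Lemma within_continuousS (A A' : set S) (f : S -> T) : A' `<=` A ->
  {within A, continuous f} -> {within A', continuous f}.
Proof.
move=> sA /within_continuousP cf; apply/within_continuousP => s As V fsV.
by apply: filterS (cf s (sA _ As) V fsV) => s' h /sA.
Qed.

(** A continuous map from a compact to a Hausdorff space is closed, so only one of
    the two continuity conditions of a homeomorphism needs to be checked. *)
Lemma compact_bijection_homeo (A : set S) (B : set T) (f : S -> T) (g : T -> S) :
  hausdorff_space S -> hausdorff_space T -> compact A ->
  (forall a, A a -> B (f a) /\ g (f a) = a) ->
  (forall b, B b -> A (g b) /\ f (g b) = b) ->
  {within A, continuous f} -> mutually_inverse_homeo A B f g.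
Proof.
move=> hS hT cA fP gP cf; split=> //.
apply/within_continuousP => b Bb V gbV.
have [W oW [gbW sWV]] : exists2 W, open W & W (g b) /\ W `<=` V.
  by move: gbV; rewrite nbhsE => -[W [oW Wgb] sW]; exists W.
have cAW : compact (A `\` W).
  apply: (subclosed_compact _ cA); last by move=> ? [].
  by apply: closedI; [exact: compact_closed|exact: open_closedC].
have : nbhs b (~` (f @` (A `\` W))).
  apply: open_nbhs_nbhs; split.
    apply: closed_openC; apply: compact_closed => //; apply: continuous_compact => //.
    by apply: within_continuousS cf => ? [].
  by move=> [a [Aa nWa] fab]; apply: nWa; rewrite -(fP _ Aa).2 fab.
apply: filterS => b' nb' Bb'; apply: sWV; apply: contrapT => nW.
have [Agb' fgb'] := gP _ Bb'; apply: nb'; exists (g b') => //.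
Qed.

End CompactTopology.

Lemma homeomorphic_of_inj {S T : topologicalType} (A : set S) (B : set T)
    (f : S -> T) (a0 : S) :
  hausdorff_space S -> hausdorff_space T -> compact A ->
  {within A, continuous f} ->
  (forall a, A a -> B (f a)) ->
  (forall a a', A a -> A a' -> f a = f a' -> a = a') ->
  (forall b, B b -> exists2 a, A a & f a = b) -> homeomorphic A B.
Proof.
move=> hS hT cA cf fAB injf surjf.
have /choice [g gP] : forall b, exists a, B b -> A a /\ f a = b.
  move=> b; have [Bb|nBb] := pselect (B b); last by exists a0.
  by have [a Aa fa] := surjf b Bb; exists a.
exists f, g; apply: compact_bijection_homeo => // a Aa.
have [Ag fg] := gP _ (fAB _ Aa); split; first exact: fAB.
exact: injf.
Qed.

Lemma compact_finite_cover {S : topologicalType} (K : set S) (O : S -> set S) :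
  compact K -> (forall q, K q -> open (O q) /\ O q q) ->
  exists l : seq S, (forall q, q \in l -> K q) /\
    (forall s, K s -> exists2 q, q \in l & O q s).
Proof.
move=> cK OP; have [[q0 Kq0]|K0] := pselect (K !=set0); last first.
  by exists [::]; split=> // s Ks; case: K0; exists s.
pose S' : ptopologicalType := HB.pack S (isPointed.Build S q0).
have : cover_compact (K : set S') by rewrite -compact_cover.
case/(_ S K (fun q => O q)) => [q /OP[]//|s Ks|l lK lc].
  by exists s => //; case: (OP _ Ks).
exists (finmap.enum_fset l); split=> [q ql|s Ks]; first by have := lK q ql; rewrite inE.
by have [q /= ql Oqs] := lc s Ks; exists q.
Qed.

Lemma homeomorphic_refl {S : topologicalType} (A : set S) : homeomorphic A A.
Proof.
by exists id, id; split=> //; apply/within_continuousP => s _ W nW;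
  apply: filterS nW.
Qed.

Lemma compact_pos_lower_bound {R : realType} {S : topologicalType} (K : set S)
    (f : S -> R) : compact K -> continuous f -> (forall s, K s -> 0 < f s) ->
  exists2 d : R, 0 < d & forall s, K s -> d <= f s.
Proof.
move=> cK cf fpos; have [K0|K0] := pselect (K !=set0); last first.
  by exists 1 => // s Ks; case: K0; exists s.
have [c] := compact_EVT_min K0 cK (continuous_subspaceT cf).
rewrite inE => Kc cmin; exists (f c); first exact: fpos.
by move=> s Ks; apply: cmin; rewrite inE.
Qed.

(** * Stretching subgraphs along vertical lines *)

Section Stretch.
Context {R : realType}.
Implicit Types (E : set (R * R)) (z : R * R) (a b : R).

Definition square (c : R) : set (R * R) := [set z | `|z.1| < c /\ `|z.2| < c].

(** Subsets of the square that are the region below a graph [a |-> height a], where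
    the graph may leave the square through its bottom or its top.  This form of the
    definition mentions no graph; the last clause says both that vertical lines meet
    [E] in a lower segment and that the height is lower semicontinuous. *)
Definition subgraph E : Prop :=
  [/\ E `<=` square 3,
      forall z, square 3 z -> ~ E z -> \forall z' \near z, ~ E z'
    & forall a b b', E (a, b) -> -3 < b' < b -> \forall a' \near a, E (a', b')].

(** The height is clamped between [-3/2] and [3/2], so that it exists and is continuous over
    the whole square; differences between subgraphs will occur in [square 1] only. *)
Definition height E a : R :=
  sup [set b | b = - (3 / 2) \/ `|b| <= 3 / 2 /\ E (a, b)].

(** On each vertical line, the affine map fixing [-2] and sending the height of [E]
    to that of [E'], extended by the identity below [-2]. *)
Definition stretch E E' z : R * R :=
  (z.1, z.2 + Num.max 0 (z.2 + 2) *
              ((height E' z.1 + 2) / (height E z.1 + 2) - 1)).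

Let hset E a := [set b | b = - (3 / 2) \/ `|b| <= 3 / 2 /\ E (a, b)].

Let hset_ub E a : ubound (hset E a) (3 / 2).
Proof. by move=> b [->|[]]; [lra | rewrite ler_norml => /andP[]]. Qed.

Let hset_neq0 E a : hset E a !=set0. Proof. by exists (- (3 / 2)); left. Qed.

Let hset_has_ub E a : has_ubound (hset E a).
Proof. by exists (3 / 2); apply: hset_ub. Qed.

Lemma height_ge_bot E a : - (3 / 2) <= height E a.
Proof. by apply: (ub_le_sup (hset_has_ub E a)); left. Qed.

Lemma height_le_top E a : height E a <= 3 / 2.
Proof. by apply: (ge_sup (hset_neq0 E a)); apply: hset_ub. Qed.

Lemma height2_gt0 E a : 0 < height E a + 2.
Proof. by have := height_ge_bot E a; lra. Qed.

Lemma height2_neq0 E a : height E a + 2 != 0.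
Proof. exact: lt0r_neq0 (height2_gt0 E a). Qed.

Lemma height_ge E a b : E (a, b) -> `|b| <= 3 / 2 -> b <= height E a.
Proof. by move=> Eab b2; apply: (ub_le_sup (hset_has_ub E a)); right. Qed.

Lemma subgraph_down E a b b' : subgraph E -> E (a, b) -> -3 < b' <= b -> E (a, b').
Proof.
case=> _ _ mE Eab /andP[b'3]; rewrite le_eqVlt => /orP[/eqP ->//|b'b].
by apply: (@nbhs_singleton _ a (fun a' => E (a', b'))); apply: mE Eab _; rewrite b'3.
Qed.

Lemma lt_height E a b : subgraph E -> - (3 / 2) <= b < height E a -> E (a, b).
Proof.
move=> sE /andP[b2 /(sup_gt (hset_neq0 E a))[b1 [->|[_ Eab1]] bb1]]; first lra.
by apply: (subgraph_down sE Eab1); apply/andP; split; lra.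
Qed.

Lemma height_mem E a : subgraph E -> `|a| < 3 -> - (3 / 2) < height E a ->
  E (a, height E a).
Proof.
move=> sE a3 h2; apply: contrapT => nE; case: (sE) => _ /(_ (a, height E a)) cE _.
have := height_le_top E a; have := height_ge_bot E a => h3 h4.
have /cE -/(_ nE) : square 3 (a, height E a) by split=> //=; rewrite ltr_norml; lra.
move=> [[P Q] /= [nP /nbhs_ballP[e /= e0 Qe]] PQ].
pose b := Num.max (- (3 / 2)) (height E a - e / 2).
have bh : - (3 / 2) <= b < height E a.
  rewrite le_max lexx /=; rewrite gt_max h2 /=; lra.
apply: (PQ (a, b)) (lt_height sE bh); split=> /=; first exact: nbhs_singleton.
apply: Qe; rewrite /ball /= ltr_norml.
have : height E a - e / 2 <= b by rewrite le_max lexx orbT.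
by move: bh => /andP[]; lra.
Qed.

Lemma height_continuous E a : subgraph E -> `|a| < 3 ->
  {for a, continuous (height E)}.
Proof.
move=> sE a3; have h1 := height_ge_bot E a; have h2 := height_le_top E a.
apply/cvgrPdist_lt => e e0; have {}e0 : (0 : R) < e := e0.
have up : \forall a' \near a, height E a' <= height E a + e / 2.
  have [b1|b1] := leP (3 / 2) (height E a + e / 2).
    by near=> a'; have := height_le_top E a'; lra.
  have nE : ~ E (a, height E a + e / 2).
    move=> /height_ge hE; suff : height E a + e / 2 <= height E a by lra.
    by apply: hE; rewrite ler_norml; lra.
  have [_ /(_ (a, height E a + e / 2)) cE _] := sE.
  have /cE/(_ nE) : square 3 (a, height E a + e / 2).
    by split => //=; rewrite ltr_norml; lra.
  move=> [[P Q] /= [nP nQ] PQ]; apply: filterS nP => a' Pa'.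
  rewrite leNgt; apply/negP => hh; apply: (PQ (a', height E a + e / 2)).
    by split=> //=; exact: nbhs_singleton.
  by apply: lt_height => //; apply/andP; split=> //; lra.
have down : \forall a' \near a, height E a - e / 2 <= height E a'.
  have [b1|b1] := leP (height E a - e / 2) (- (3 / 2)).
    by near=> a'; have := height_ge_bot E a'; lra.
  have h3 : - (3 / 2) < height E a by lra.
  have Eh := height_mem sE a3 h3.
  have [_ _ mE] := sE; have : \forall a' \near a, E (a', height E a - e / 2).
    by apply: mE Eh _; lra.
  apply: filterS => a' Ea'; apply: height_ge => //; rewrite ler_norml; lra.
near=> a'; rewrite ltr_norml.
have : height E a' <= height E a + e / 2 by near: a'.
have : height E a - e / 2 <= height E a' by near: a'.
lra.
Unshelve. all: by end_near. Qed.

Lemma stretch_continuous E E' z : subgraph E -> subgraph E' -> square 3 z ->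
  {for z, continuous (stretch E E')}.
Proof.
move=> sE sE' [z1 z2].
suff c2 : (stretch E E' y).2 @[y --> z] --> (stretch E E' z).2.
  exact: (cvg_pair cvg_fst c2).
have ch F : subgraph F -> height F y.1 @[y --> z] --> height F z.1.
  by move=> sF; apply: (cvg_comp _ _ cvg_fst); exact: height_continuous.
apply: cvgD; first exact: cvg_snd.
apply: cvgM.
  apply: (@continuous_max _ _ (fun=> 0) (fun y : R * R => y.2 + 2)).
    exact: cvg_cst.
  by apply: cvgD; [exact: cvg_snd | exact: cvg_cst].
apply: cvgB; last exact: cvg_cst.
apply: cvgM; first by apply: cvgD; [exact: ch | exact: cvg_cst].
apply: cvgV; first exact: height2_neq0.
by apply: cvgD; [exact: ch | exact: cvg_cst].
Qed.

Lemma stretch_low E E' z : z.2 <= -2 -> stretch E E' z = z.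
Proof.
by case: z => a b /= h; rewrite /stretch /= max_l ?mul0r ?addr0 //; lra.
Qed.

Lemma stretch_same E E' z : height E z.1 = height E' z.1 -> stretch E E' z = z.
Proof.
case: z => a b /= h; by rewrite /stretch /= h divff ?height2_neq0 // subrr mulr0 addr0.
Qed.

Lemma stretch_high E E' z : -2 < z.2 ->
  stretch E E' z = (z.1, -2 + (z.2 + 2) * ((height E' z.1 + 2) / (height E z.1 + 2))).
Proof. by case: z => a b /= h; rewrite /stretch /= max_r; [congr pair; ring | lra]. Qed.

Lemma stretchK E E' : cancel (stretch E E') (stretch E' E).
Proof.
move=> z; have [z2|z2] := leP z.2 (-2).
  by rewrite (stretch_low E E' z2) stretch_low.
rewrite (stretch_high E E' z2) stretch_high /=; last first.
  by rewrite ltrDl mulr_gt0 ?divr_gt0 ?height2_gt0 //; lra.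
case: z z2 => a b /= z2; congr pair.
by field; rewrite !height2_neq0.
Qed.

Section Support.
Variables E E' : set (R * R).
Hypotheses (sE : subgraph E) (sE' : subgraph E') (EE' : E `<=` E').
Hypothesis diffE : forall z, E' z -> ~ E z -> square 1 z.

Lemma height_mono a : `|a| < 3 -> height E a <= height E' a.
Proof.
move=> a3; rewrite leNgt; apply/negP => h.
have h2 : - (3 / 2) < height E a by apply: le_lt_trans h; exact: height_ge_bot.
suff : height E a <= height E' a by rewrite leNgt h.
apply: height_ge; first exact: EE' (height_mem sE a3 h2).
by rewrite ler_norml ltW //=; exact: height_le_top.
Qed.

Lemma height_neq a : `|a| < 3 -> height E a != height E' a -> `|a| < 1.
Proof.
move=> a3 /eqP hh; apply: contrapT => na; apply: hh; congr sup.
rewrite predeqE => b; split=> -[->|[b2 Eb]]; [by left| |by left|]; right; split=> //.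
  exact: EE'.
by apply: contrapT => nE; apply: na; case: (diffE Eb nE).
Qed.

(** A point of [E] above the clamping height forces both heights to be maximal. *)
Lemma stretch_top z : E z -> 3 / 2 < z.2 -> height E z.1 = height E' z.1.
Proof.
case: z => a b /= Eab b2; have [a3 b3] : square 3 (a, b) by case: sE => + _ _; apply.
have /= h : E (a, 3 / 2) by apply: (subgraph_down sE Eab); lra.
have h1 : 3 / 2 <= height E a by apply: height_ge => //; rewrite ger0_norm; lra.
have h2 := height_mono a3; have := height_le_top E' a; lra.
Qed.

Lemma stretch_in z : E z -> E' (stretch E E' z).
Proof.
move=> Ez; have [z2|z2] := leP z.2 (-2); first by rewrite stretch_low //; exact: EE'.
have [z3|z3] := ltP (3 / 2) z.2.
  by rewrite stretch_same; [exact: EE' | exact: stretch_top].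
rewrite stretch_high //; case: z Ez z2 z3 => a b /= Eab b2 b3.
have [/= a3 _] : square 3 (a, b) by case: sE => + _ _; apply.
have h2 := height_mono a3; have h1 := height_ge_bot E a.
have bh : b <= height E a.
  have [b4|b4] := leP (- (3 / 2)) b; last by lra.
  by apply: height_ge => //; rewrite ler_norml b4.
have [/eqP h0|h0] := boolP (height E' a == - (3 / 2)).
  have -> : height E a = height E' a by lra.
  by rewrite divff ?height2_neq0 // mulr1 addrC addrK; exact: EE'.
have h3 : - (3 / 2) < height E' a by rewrite lt_neqAle eq_sym h0 height_ge_bot.
apply: (subgraph_down sE' (height_mem sE' a3 h3)); apply/andP; split.
  suff : 0 <= (b + 2) * ((height E' a + 2) / (height E a + 2)) by lra.
  by rewrite mulr_ge0 ?divr_ge0 //; lra.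
rewrite -lerBrDl opprK mulrCA ger_pMr; last by lra.
by rewrite ler_pdivrMr ?mul1r; lra.
Qed.

Lemma stretch_out z : E' z -> E (stretch E' E z).
Proof.
move=> Ez; have Edec y : ~ square 1 y -> E' y -> E y.
  by move=> ny Ey; apply: contrapT => /(diffE Ey).
have nsq y : 1 <= `|y.2| -> ~ square 1 y by move=> h [_]; rewrite ltNge h.
have [z2|z2] := leP z.2 (-2).
  by rewrite stretch_low //; apply: Edec Ez; apply: nsq; rewrite ler0_norm; lra.
have [z3|z3] := ltP (3 / 2) z.2.
  have Ez' : E z by apply: Edec Ez; apply: nsq; rewrite ger0_norm; lra.
  by rewrite stretch_same //; apply/esym; exact: stretch_top.
rewrite stretch_high //; case: z Ez z2 z3 => a b /= Eab b2 b3.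
have [/= a3 _] : square 3 (a, b) by case: sE' => + _ _; apply.
have h2 := height_mono a3; have h1 := height_ge_bot E a.
have bh : b <= height E' a.
  have [b4|b4] := leP (- (3 / 2)) b; last by have := height_ge_bot E' a; lra.
  by apply: height_ge => //; rewrite ler_norml b4.
have [/eqP h0|h0] := boolP (height E a == - (3 / 2)).
  (* otherwise [E'] would have a point between [-3/2] and [-1] that is not in [E],
     outside [square 1] *)
  have h3 : height E' a = height E a.
    apply/eqP; rewrite eq_le h2 andbT leNgt; apply/negP => h3.
    pose b1 := Num.min (height E' a) (- (5 / 4)).
    have b1h : b1 <= height E' a by rewrite ge_min lexx.
    have b15 : b1 <= - (5 / 4) by rewrite ge_min lexx orbT.
    have b13 : - (3 / 2) < b1 by rewrite lt_min; apply/andP; split; lra.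
    have Eb1 : E' (a, b1).
      apply: (subgraph_down sE' (height_mem sE' a3 _)); first by lra.
      by apply/andP; split; lra.
    have : E (a, b1) by apply: Edec Eb1; apply: nsq; rewrite ler0_norm /=; lra.
    move=> /height_ge hb1; have : b1 <= height E a; last by lra.
    by apply: hb1; rewrite ler_norml; lra.
  rewrite h3 divff ?height2_neq0 // mulr1 addrC addrK; apply: Edec Eab; apply: nsq => /=; rewrite ler0_norm; lra.
have h3 : - (3 / 2) < height E a by rewrite lt_neqAle eq_sym h0 height_ge_bot.
apply: (subgraph_down sE (height_mem sE a3 h3)); apply/andP; split.
  suff : 0 <= (b + 2) * ((height E a + 2) / (height E' a + 2)) by lra.
  by rewrite mulr_ge0 ?divr_ge0 //; lra.
rewrite -lerBrDl opprK mulrCA ger_pMr; last by lra.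
by rewrite ler_pdivrMr ?mul1r; lra.
Qed.

(** Points are moved only inside a compact part of the square; this makes the
    stretching extend continuously by the identity. *)
Lemma stretch_support z : E z -> stretch E E' z != z ->
  `|z.1| <= 2 /\ `|z.2| <= 2.
Proof.
move=> Ez nz; have [/= z13 _] : square 3 z by case: sE => + _ _; apply.
have /(height_neq z13) z1 : height E z.1 != height E' z.1.
  by apply: contra_neq nz; exact: stretch_same.
split; first by lra.
rewrite ler_norml; apply/andP; split.
  by rewrite leNgt; apply: contra_neqN nz => h; apply: stretch_low; exact: ltW.
have [|h] := leP z.2 2; first by lra.
by move/eqP: nz; case; apply: stretch_same; apply: stretch_top => //; lra.
Qed.

End Support.
End Stretch.

(** * Euclidean vectors *)

Section VectorNorm.
Context {R : realType} {n : nat}.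
Implicit Types (v w : 'rV[R]_n).

Lemma coord_le_norm v i : `|v 0 i| <= `|v|.
Proof.
rewrite /Num.norm /= mx_normrE.
exact: (le_bigmax _ (fun ij : 'I_1 * 'I_n => `|v ij.1 ij.2|) (0, i)).
Qed.

Lemma norm_le_coord v (c : R) : 0 <= c -> (forall i, `|v 0 i| <= c) -> `|v| <= c.
Proof.
move=> c0 vc; rewrite /Num.norm /= mx_normrE; apply/bigmax_leP; split=> // -[i j] _ /=.
by rewrite ord1; exact: vc.
Qed.

Lemma norm_lt_coord v (c : R) : 0 < c -> (forall i, `|v 0 i| < c) -> `|v| < c.
Proof.
move=> c0 vc; rewrite /Num.norm /= mx_normrE; apply/bigmax_ltP; split=> // -[i j] _ /=.
by rewrite ord1; exact: vc.
Qed.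

Lemma dotvC v w : dotv v w = dotv w v.
Proof. by apply: eq_bigr => i _; rewrite mulrC. Qed.

Lemma dotvDl u v w : dotv (u + v) w = dotv u w + dotv v w.
Proof. by rewrite -big_split; apply: eq_bigr => i _; rewrite mxE mulrDl. Qed.

Lemma dotvZl a v w : dotv (a *: v) w = a * dotv v w.
Proof. by rewrite mulr_sumr; apply: eq_bigr => i _; rewrite mxE mulrA. Qed.

Lemma dotvDr u v w : dotv u (v + w) = dotv u v + dotv u w.
Proof. by rewrite dotvC dotvDl !(dotvC u). Qed.

Lemma dotvZr a v w : dotv v (a *: w) = a * dotv v w.
Proof. by rewrite dotvC dotvZl dotvC. Qed.

Lemma dotvNl v w : dotv (- v) w = - dotv v w.
Proof. by rewrite -scaleN1r dotvZl mulN1r. Qed.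

Lemma dotv0l v : dotv 0 v = 0.
Proof. by rewrite -(scale0r (0 : 'rV_n)) dotvZl mul0r. Qed.

Lemma dotv_suml (I : Type) (r : seq I) (F : I -> 'rV[R]_n) v :
  dotv (\sum_(i <- r) F i) v = \sum_(i <- r) dotv (F i) v.
Proof.
elim: r => [|i r IH]; first by rewrite !big_nil dotv0l.
by rewrite !big_cons dotvDl IH.
Qed.

Lemma dotv_sumr (I : Type) (r : seq I) (F : I -> 'rV[R]_n) v :
  dotv v (\sum_(i <- r) F i) = \sum_(i <- r) dotv v (F i).
Proof. by rewrite dotvC dotv_suml; apply: eq_bigr => i _; rewrite dotvC. Qed.

Lemma dotv_ge0 v : 0 <= dotv v v.
Proof. by apply: sumr_ge0 => i _; rewrite -expr2 sqr_ge0. Qed.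

Lemma dotv_eq0 v : dotv v v = 0 -> v = 0.
Proof.
move=> v0; apply/rowP => i; rewrite mxE; apply/eqP; rewrite -sqrf_eq0 expr2.
apply/eqP; move: v0 => /eqP; rewrite psumr_eq0; last by move=> j _; rewrite -expr2 sqr_ge0.
by move=> /allP/(_ i); rewrite mem_index_enum => /(_ isT)/eqP.
Qed.

Lemma dotv_gt0 v : v != 0 -> 0 < dotv v v.
Proof. by move=> v0; rewrite lt0r dotv_ge0 andbT; apply: contra_neq v0; exact: dotv_eq0. Qed.

Lemma enorm_sqr v : enorm v ^+ 2 = dotv v v.
Proof. by rewrite sqr_sqrtr ?dotv_ge0. Qed.

Lemma enorm_ge0 v : 0 <= enorm v. Proof. exact: sqrtr_ge0. Qed.

Lemma norm_sqr_le_dotv v : `|v| ^+ 2 <= dotv v v.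
Proof.
rewrite -enorm_sqr ler_sqr ?nnegrE ?enorm_ge0 //; apply: norm_le_coord => [|i].
  exact: enorm_ge0.
rewrite -(sqrtr_sqr (v 0 i)) ler_sqrt ?dotv_ge0 // /dotv (bigD1 i) //= -expr2 lerDl.
by apply: sumr_ge0 => j _; rewrite -expr2 sqr_ge0.
Qed.

(** Cauchy-Schwarz, from the nonnegativity of [|<w,w> v - <v,w> w|^2]. *)
Lemma dotv_sqr_le v w : dotv v w ^+ 2 <= dotv v v * dotv w w.
Proof.
have [->|w0] := eqVneq w 0; first by rewrite dotvC !dotv0l expr0n /= mulr0.
have := dotv_ge0 (dotv w w *: v + (- dotv v w) *: w).
rewrite !(dotvDl, dotvDr, dotvZl, dotvZr) (dotvC w v).
move=> h; rewrite -(ler_pM2r (dotv_gt0 w0)) -subr_ge0.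
by apply: le_trans h _; rewrite le_eqVlt; apply/orP; left; apply/eqP; ring.
Qed.

Lemma dotv_le_enorm v w : `|dotv v w| <= enorm v * enorm w.
Proof.
rewrite -sqrtrM ?dotv_ge0 // -sqrtr_sqr ler_sqrt; first exact: dotv_sqr_le.
by rewrite mulr_ge0 ?dotv_ge0.
Qed.

End VectorNorm.

Lemma enormZ {R : realType} {n : nat} (a : R) (v : 'rV[R]_n) :
  enorm (a *: v) = `|a| * enorm v.
Proof.
rewrite /enorm; have -> : dotv (a *: v) (a *: v) = a ^+ 2 * dotv v v.
  by rewrite /dotv mulr_sumr; apply: eq_bigr => i _; rewrite !mxE; ring.
by rewrite sqrtrM ?sqr_ge0 // sqrtr_sqr.
Qed.

Lemma enorm_delta {R : realType} {n : nat} (i : 'I_n) :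
  enorm (delta_mx 0 i : 'rV[R]_n) = 1.
Proof.
rewrite /enorm /dotv (bigD1 i) //= big1 ?addr0; first by rewrite !mxE !eqxx mulr1 sqrtr1.
by move=> j ji; rewrite !mxE (negbTE ji) andbF mulr0.
Qed.

Lemma norm_le_enorm {R : realType} {n : nat} (v : 'rV[R]_n) : `|v| <= enorm v.
Proof.
by rewrite -ler_sqr ?nnegrE ?enorm_ge0 // enorm_sqr; exact: norm_sqr_le_dotv.
Qed.

Lemma enorm_gt0 {R : realType} {n : nat} (v : 'rV[R]_n) : v != 0 -> 0 < enorm v.
Proof. by move=> v0; rewrite sqrtr_gt0; exact: dotv_gt0. Qed.

(** * Boxes adapted to a function *)

(** The largest [w] with [f a < f w] cannot be below [b]. *)
Lemma locally_increasing {R : realType} (f : R -> R) (a b : R) : a < b ->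
  (forall u, a <= u <= b -> exists2 e : R, 0 < e &
     forall v w, a <= v <= b -> a <= w <= b -> `|v - u| < e -> `|w - u| < e ->
       v < w -> f v < f w) ->
  f a < f b.
Proof.
move=> ab floc; pose A := [set w | a <= w <= b /\ (w = a \/ f a < f w)].
have Aa : A a by split; [rewrite lexx ltW | left].
have ubA : ubound A b by move=> w [/andP[]].
have am : a <= sup A by apply: ub_le_sup => //; exists b.
have mb : sup A <= b by apply: ge_sup => //; exists a.
have mab : a <= sup A <= b by rewrite am.
have [e e0 fe] := floc _ mab.
have Am : A (sup A).
  have [w [wab wa] mw] : exists2 w, A w & sup A - e < w.
    by apply: sup_adherent => //; split; [exists a | exists b].
  split=> //; have wm : w <= sup A by apply: ub_le_sup; [exists b | split].
  move: wm; rewrite le_eqVlt => /orP[/eqP <- //|wm]; right.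
  have : f w < f (sup A).
    by apply: fe => //; rewrite ?subrr ?normr0 // ltr_norml; lra.
  by case: wa => [->//|]; exact: lt_trans.
have [mb'|mb'] := leP b (sup A).
  have <- : sup A = b by lra.
  case: Am => _ [mEa|//]; lra.
pose w := Num.min b (sup A + e / 2).
have wb : w <= b by rewrite ge_min lexx.
have we : w <= sup A + e / 2 by rewrite ge_min lexx orbT.
have mw : sup A < w by rewrite lt_min mb' /=; lra.
have wab : a <= w <= b by apply/andP; split => //; lra.
suff : w <= sup A by lra.
apply: ub_le_sup; first by exists b.
split => //; right.
have : f (sup A) < f w.
  by apply: fe => //; rewrite ?subrr ?normr0 // ltr_norml; lra.
by case: Am => _ [->//|]; exact: lt_trans.
Qed.

(** Coordinates [(a, t)] on an open set [box_rng] of a surface, ranging over the part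
    of [square 3] that lies in [box_dom].  At an interior point [box_dom] contains the
    square; at a boundary point it is the lower half. *)
Record box {R : realType} {S : topologicalType} := Box {
  box_dom : set (R * R);
  box_rng : set S;
  box_par : R * R -> S;
  box_coord : S -> R * R;
  box_slope : R;
  box_radius : R }.

Section Boxes.
Context {R : realType} {S : topologicalType} {V : normedModType R}.
Variables (x : S -> V) (phi : S -> R).
Hypotheses (hS : hausdorff_space S) (cS : compact [set: S]).
Hypotheses (cx : continuous x) (cphi : continuous phi).
Implicit Types (b : @box R S) (G H : S -> R) (q s : S) (z : R * R).

Definition box_half b : set (R * R) := square 3 `&` box_dom b.

(** A box around [q] along whose vertical lines [phi] increases, at a rate controlling
    the displacement of [x].  The last clause makes the distance [|x - x q|] a
    substitute for a coordinate distance: it is bounded below off the core of the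
    box, although [x] need not be injective globally. *)
Record box_at q b : Prop := BoxAt {
  box_closed : closed (box_dom b);
  box_down : forall z z', box_dom b z -> square 3 z' -> z'.2 <= z.2 -> box_dom b z';
  box_open : open (box_rng b);
  box_homeo : mutually_inverse_homeo (box_half b) (box_rng b) (box_par b) (box_coord b);
  box_center : box_half b (0, 0) /\ box_par b (0, 0) = q;
  box_slope_gt0 : 0 < box_slope b;
  box_radius_gt0 : 0 < box_radius b;
  box_up : forall a t u, box_half b (a, t) -> box_half b (a, u) -> t < u ->
    phi (box_par b (a, t)) < phi (box_par b (a, u)) /\
    `|x (box_par b (a, u)) - x (box_par b (a, t))| <=
      box_slope b * (phi (box_par b (a, u)) - phi (box_par b (a, t)));
  box_apart : forall z, box_half b z -> ~ square 1 z ->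
    box_radius b <= `|x (box_par b z) - x q| }.

(** Lipschitz with respect to the pseudometric [|x s1 - x s2|], which needs no chart,
    so that one constant serves in all boxes. *)
Definition locally_lipschitz (M : R) G : Prop :=
  forall s, \forall s1 & s2 \near s, `|G s1 - G s2| <= M * `|x s1 - x s2|.

Lemma locally_lipschitzP M G : locally_lipschitz M G <->
  forall s, exists2 W, nbhs s W &
    forall s1 s2, W s1 -> W s2 -> `|G s1 - G s2| <= M * `|x s1 - x s2|.
Proof.
split=> lG s.
  have [[P Q] /= [nP nQ] PQ] := lG s; exists (P `&` Q); first exact: filterI.
  by move=> s1 s2 [P1 _] [_ Q2]; apply: (PQ (s1, s2)).
by have [W nW lW] := lG s; exists (W, W) => //= -[s1 s2] [] /=; exact: lW.
Qed.

Lemma locally_lipschitz_continuous M G : locally_lipschitz M G -> continuous G.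
Proof.
move=> /locally_lipschitzP lG s; have [W nW lW] := lG s.
have Ws := nbhs_singleton nW.
apply/cvgrPdist_lt => e e0; have e1 : 0 < e / (`|M| + 1) by rewrite divr_gt0.
have /cvgrPdist_lt/(_ _ e1) : x t @[t --> s] --> x s by exact: cx.
apply: filterS2 nW => t Wt xst.
apply: (le_lt_trans (lW s t Ws Wt)).
apply: (@le_lt_trans _ _ ((`|M| + 1) * `|x s - x t|)).
  by rewrite ler_wpM2r // (le_trans (ler_norm _)) // lerDl.
by rewrite mulrC -ltr_pdivlMr.
Qed.

Lemma locally_lipschitzD M1 M2 G1 G2 : locally_lipschitz M1 G1 ->
  locally_lipschitz M2 G2 -> locally_lipschitz (M1 + M2) (G1 \+ G2).
Proof.
move=> /locally_lipschitzP l1 /locally_lipschitzP l2; apply/locally_lipschitzP => s.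
have [W1 nW1 lW1] := l1 s; have [W2 nW2 lW2] := l2 s.
exists (W1 `&` W2); first exact: filterI.
move=> s1 s2 [W11 W21] [W12 W22] /=; rewrite opprD addrACA mulrDl.
by apply: (le_trans (ler_normD _ _)); apply: lerD; [exact: lW1 | exact: lW2].
Qed.

Lemma locally_lipschitzZ e G : 0 <= e -> locally_lipschitz 1 G ->
  locally_lipschitz e (fun s => e * G s).
Proof.
move=> e0 /locally_lipschitzP lG; apply/locally_lipschitzP => s.
have [W nW lW] := lG s; exists W => // s1 s2 W1 W2.
rewrite -mulrBr normrM ger0_norm // ler_wpM2l //.
by have := lW _ _ W1 W2; rewrite mul1r.
Qed.

Lemma locally_lipschitz_min M G c : 0 <= M -> locally_lipschitz M G ->
  locally_lipschitz M (fun s => Num.min c (G s)).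
Proof.
move=> M0 /locally_lipschitzP lG; apply/locally_lipschitzP => s.
have [W nW lW] := lG s; exists W => // s1 s2 W1 W2.
apply: le_trans (lW s1 s2 W1 W2); rewrite /Num.min.
have [h1|h1] := ltP c (G s1); have [h2|h2] := ltP c (G s2); rewrite // ?subrr ?normr0 //.
  by rewrite !ger0_norm; lra.
by rewrite !ler0_norm; lra.
Qed.

Lemma locally_lipschitz_cst c : locally_lipschitz 0 (fun=> c).
Proof.
apply/locally_lipschitzP => s; exists setT; first exact: filterT.
by move=> s1 s2 _ _; rewrite subrr normr0 mul0r.
Qed.

Section OneBox.
Variables (q : S) (b : @box R S).
Hypothesis bP : box_at q b.
Let D := box_half b.
Let B := box_rng b.
Let p := box_par b.
Let k := box_coord b.

Lemma box_parP z : D z -> B (p z) /\ k (p z) = z.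
Proof. by case: (box_homeo bP) => + _ _ _; apply. Qed.

Lemma box_coordP s : B s -> D (k s) /\ p (k s) = s.
Proof. by case: (box_homeo bP) => _ + _ _; apply. Qed.

Lemma box_par_near z (W : set S) : D z -> nbhs (p z) W ->
  \forall z' \near z, D z' -> W (p z').
Proof.
by case: (box_homeo bP) => _ _ /within_continuousP + _ => + Dz nW; apply.
Qed.

Lemma box_coord_near s (W : set (R * R)) : B s -> nbhs (k s) W ->
  \forall s' \near s, B s' /\ W (k s').
Proof.
case: (box_homeo bP) => _ _ _ /within_continuousP ck Bs nW.
have nB : nbhs s B by apply: open_nbhs_nbhs; split => //; exact: box_open bP.
by apply: filterS2 nB (ck s Bs W nW) => s' Bs' h; split => //; exact: h.
Qed.

Lemma box_core_closed c : c < 3 ->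
  closed (p @` (box_dom b `&` [set z | `|z.1| <= c /\ `|z.2| <= c])).
Proof.
move=> c3; apply: compact_closed => //; apply: continuous_compact.
  case: (box_homeo bP) => _ _ cp _; apply: within_continuousS cp.
  by move=> z [Dz [z1 z2]]; split=> //; split; lra.
have -> : box_dom b `&` [set z | `|z.1| <= c /\ `|z.2| <= c] =
    (`[- c, c] `*` `[- c, c]) `&` box_dom b.
  by rewrite setIC; congr (_ `&` _); rewrite predeqE => z; split;
     rewrite /= !in_itv /= -!ler_norml.
apply: compact_closedI; last exact: box_closed bP.
by apply: compact_setX; exact: segment_compact.
Qed.

Lemma box_down_half z z' : D z -> square 3 z' -> z'.2 <= z.2 -> D z'.
Proof. by move=> [_ dz] s3 h; split=> //; exact: box_down bP _ _ dz s3 h. Qed.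

(** Along a vertical line [G] grows at most [M * box_slope b < 1] times as fast as
    [phi].  The Lipschitz bound being local, this is first proved locally. *)
Lemma box_level_increasing M G a t u : locally_lipschitz M G ->
  M * box_slope b < 1 -> D (a, t) -> D (a, u) -> t < u ->
  phi (p (a, t)) - G (p (a, t)) < phi (p (a, u)) - G (p (a, u)).
Proof.
move=> /locally_lipschitzP lG MC Dt Du tu.
have Dv v : t <= v <= u -> D (a, v).
  move=> tvu; apply: (box_down_half Du) => /=; last by lra.
  have [[/= a3 t3] _] := Dt; have [[/= _ u3] _] := Du.
  by split=> //=; move: t3 u3; rewrite !ltr_norml; lra.
apply: (@locally_increasing R (fun v => phi (p (a, v)) - G (p (a, v)))) => // v vtu.
have [W nW lW] := lG (p (a, v)).
have [[P Q] /= [nP /nbhs_ballP[e /= e0 Qe]] PQ] := box_par_near (Dv v vtu) nW.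
have We w : t <= w <= u -> `|w - v| < e -> W (p (a, w)).
  move=> wtu wv; apply: (PQ (a, w)); last exact: Dv.
  by split=> /=; [exact: nbhs_singleton | apply: Qe; rewrite /ball /= distrC].
exists e => // v1 v2 v1tu v2tu v1e v2e v12.
have [ph hx] := box_up bP (Dv _ v1tu) (Dv _ v2tu) v12.
have := lW _ _ (We _ v2tu v2e) (We _ v1tu v1e); set dG := G _ - G _ => hG.
have {}hG := le_trans (ler_norm _) hG.
have [M0|M0] := leP M 0.
  have : M * `|x (p (a, v2)) - x (p (a, v1))| <= 0 by rewrite mulr_le0_ge0.
  by rewrite /dG /p in hG *; lra.
have : M * `|x (p (a, v2)) - x (p (a, v1))| <=
    (M * box_slope b) * (phi (p (a, v2)) - phi (p (a, v1))).
  by rewrite -mulrA ler_pM2l.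
have : (M * box_slope b) * (phi (p (a, v2)) - phi (p (a, v1))) <
    phi (p (a, v2)) - phi (p (a, v1)).
  by rewrite gtr_pMl // subr_gt0.
by rewrite /dG /p in hG *; lra.
Qed.

Lemma box_subgraph M G : locally_lipschitz M G -> M * box_slope b < 1 ->
  subgraph (D `&` [set z | phi (p z) <= G (p z)]).
Proof.
move=> lG MC; have cG := locally_lipschitz_continuous lG.
have cF : continuous (fun s => phi s - G s).
  by move=> s; apply: cvgB; [exact: cphi | exact: cG].
split=> [z [[]]//|z s3 nE|a t u [Dat /= lev] tu].
- have [dz|ndz] := pselect (box_dom b z); last first.
    have : nbhs z (~` box_dom b).
      by apply: open_nbhs_nbhs; split => //; apply: closed_openC; exact: box_closed bP.
    by apply: filterS => z' nd [[]].
  have Dz : D z by [].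
  have : nbhs (p z) [set s | 0 < phi s - G s].
    apply: (cF (p z) [set t : R | 0 < t]); apply: lt_nbhsr.
    by rewrite subr_gt0 ltNge; apply/negP => h; apply: nE.
  move=> /(box_par_near Dz); apply: filterS => z' h [Dz' /= lz'].
  by have /= := h Dz'; lra.
- have Dau : D (a, u).
    apply: (box_down_half Dat) => /=; last by lra.
    have [[/= a3 t3] _] := Dat.
    by split=> //=; move: t3; rewrite !ltr_norml; lra.
  have ut : u < t by lra.
  have inc := box_level_increasing lG MC Dau Dat ut.
  have : nbhs (p (a, u)) [set s | phi s - G s < 0].
    by by apply: (cF (p (a, u)) [set t : R | t < 0]); apply: lt_nbhsl; lra.
  move=> /(box_par_near Dau)[[P Q] /= [nP nQ] PQ].
  have [[/= a3 u3] _] := Dau.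
  have : \forall a' \near a, `|a'| < 3.
    apply/nbhs_ballP; exists (3 - `|a|); first by rewrite /= subr_gt0.
    by move=> a'; rewrite /ball /= => h; have := ler_normB a (a - a'); rewrite subKr; lra.
  apply: filterS2 nP => a' Pa' a'3.
  have Da' : D (a', u) by apply: (box_down_half Dau).
  split=> //=; have /= : phi (p (a', u)) - G (p (a', u)) < 0; last by lra.
  by apply: (PQ (a', u)) => //; split=> //=; exact: nbhs_singleton.
Qed.

(** In the coordinates of the box the two sublevel sets are subgraphs that differ in
    [square 1] only, so the stretching between them, extended by the identity outside
    the box, is the homeomorphism. *)
Lemma box_push M G0 G1 (N : set S) :
  locally_lipschitz M G0 -> locally_lipschitz M G1 -> M * box_slope b < 1 ->
  (forall s, G0 s <= G1 s) ->
  (forall s, G0 s < G1 s -> B s /\ square 1 (k s)) ->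
  B `<=` N -> compact (N `&` [set s | phi s <= G0 s]) ->
  homeomorphic (N `&` [set s | phi s <= G0 s]) (N `&` [set s | phi s <= G1 s]).
Proof.
move=> l0 l1 MC G01 diffG BN cA.
pose E0 := D `&` [set z | phi (p z) <= G0 (p z)].
pose E1 := D `&` [set z | phi (p z) <= G1 (p z)].
have s0 : subgraph E0 by exact: box_subgraph l0 MC.
have s1 : subgraph E1 by exact: box_subgraph l1 MC.
have E01 : E0 `<=` E1 by move=> z [Dz /= h]; split=> //=; exact: le_trans h (G01 _).
have dE z : E1 z -> ~ E0 z -> square 1 z.
  move=> [Dz /= h1] h0; have [Bp <-] := box_parP Dz.
  apply: (diffG _ _).2; apply: lt_le_trans h1; rewrite ltNge; apply/negP => h.
  exact: h0.
pose f s := if s \in B then p (stretch E0 E1 (k s)) else s.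
pose g s := if s \in B then p (stretch E1 E0 (k s)) else s.
have fB s : B s -> f s = p (stretch E0 E1 (k s)) by move=> Bs; rewrite /f mem_set.
have gB s : B s -> g s = p (stretch E1 E0 (k s)) by move=> Bs; rewrite /g mem_set.
have fN s : ~ B s -> f s = s by move=> Bs; rewrite /f memNset.
have gN s : ~ B s -> g s = s by move=> Bs; rewrite /g memNset.
exists f, g; apply: compact_bijection_homeo => //.
- move=> s [Ns /= ls]; have [Bs|nBs] := pselect (B s); last first.
    by rewrite fN ?gN //; split=> //; split=> //=; exact: le_trans ls (G01 _).
  have [Dk pk] := box_coordP Bs.
  have : E1 (stretch E0 E1 (k s)).
    by apply: stretch_in => //; split=> //=; rewrite pk.
  rewrite fB // => -[Dst /= lst]; have [Bst kst] := box_parP Dst.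
  split; first by split=> //; exact: BN.
  by rewrite gB // kst stretchK pk.
- move=> s [Ns /= ls]; have [Bs|nBs] := pselect (B s); last first.
    rewrite gN ?fN //; split=> //; split=> //=; apply: le_trans ls _.
    by rewrite leNgt; apply/negP => /diffG[].
  have [Dk pk] := box_coordP Bs.
  have : E0 (stretch E1 E0 (k s)).
    by apply: stretch_out => //; split=> //=; rewrite pk.
  rewrite gB // => -[Dst /= lst]; have [Bst kst] := box_parP Dst.
  split; first by split=> //; exact: BN.
  by rewrite fB // kst stretchK pk.
- apply/within_continuousP => s [Ns /= ls] W nW.
  have EB t : B t -> phi t <= G0 t -> E0 (k t).
    by move=> Bt lt; have [Dk pk] := box_coordP Bt; split=> //=; rewrite pk.
  have [Bs|nBs] := pselect (B s).
    have [Dk pk] := box_coordP Bs; have Ek := EB s Bs ls.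
    have [Dst _] : E1 (stretch E0 E1 (k s)) by exact: stretch_in.
    move: nW; rewrite fB // => /(box_par_near Dst) nW.
    have [s3 _] := Dk.
    have /(box_coord_near Bs) := stretch_continuous s0 s1 s3 nW.
    apply: filterS => t [Bt h] [Nt lt]; rewrite fB //; apply: h.
    by have [] := stretch_in s0 s1 E01 (EB t Bt lt).
  have c23 : (2 : R) < 3 by lra.
  have nZ : nbhs s (~` (p @` (box_dom b `&` [set z | `|z.1| <= 2 /\ `|z.2| <= 2]))).
    apply: open_nbhs_nbhs; split; first by apply: closed_openC; exact: box_core_closed.
    move=> [z [dz [z1 z2]] zs]; apply: nBs; rewrite -zs.
    by apply: (box_parP _).1; split=> //; split; lra.
  move: nW; rewrite fN // => nW; apply: filterS2 nZ nW => t nZt Wt [Nt lt].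
  have [Bt|nBt] := pselect (B t); last by rewrite fN.
  have [[k3 dk] pk] := box_coordP Bt; rewrite fB //.
  have [->|/eqP hst] := pselect (stretch E0 E1 (k t) = k t); first by rewrite pk.
  have := stretch_support s0 E01 dE (EB t Bt lt) hst.
  by move=> k2; case: nZt; exists (k t).
Qed.

Definition box_bump s : R :=
  if s \in B then Num.max 0 (box_radius b - `|x s - x q|) else 0.

Lemma box_bump_ge0 s : 0 <= box_bump s.
Proof. by rewrite /box_bump; case: ifP => // _; rewrite le_max lexx. Qed.

Lemma box_bump_support s : 0 < box_bump s -> B s /\ square 1 (k s).
Proof.
rewrite /box_bump; case: ifPn => [|_]; last by rewrite ltxx.
rewrite inE => Bs; rewrite lt_max ltxx /= subr_gt0 => h; split=> //.
have [Dk pk] := box_coordP Bs; apply: contrapT => nk.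
by have := box_apart bP Dk nk; rewrite -/p pk leNgt h.
Qed.

Lemma box_bump_center : 0 < box_bump q.
Proof.
have [D0 p0] := box_center bP; have [B0 _] := box_parP D0.
rewrite /box_bump mem_set; last by rewrite -p0.
by rewrite subrr normr0 subr0 lt_max (box_radius_gt0 bP) orbT.
Qed.

(** Each point has a neighbourhood on which the bump is either given by the formula
    or zero; it is zero off a compact part of the box. *)
Lemma box_bump_lipschitz : locally_lipschitz 1 box_bump.
Proof.
apply/locally_lipschitzP => s; have [Bs|nBs] := pselect (B s).
  exists B; first by apply: open_nbhs_nbhs; split=> //; exact: box_open bP.
  move=> s1 s2 B1 B2; rewrite mul1r /box_bump !mem_set //.
  set r := box_radius b.
  have h : `|(r - `|x s1 - x q|) - (r - `|x s2 - x q|)| <= `|x s1 - x s2|.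
    have -> : (r - `|x s1 - x q|) - (r - `|x s2 - x q|) =
      `|x s2 - x q| - `|x s1 - x q| by ring.
    by apply: (le_trans (ler_dist_dist _ _)); rewrite opprB addrA subrK distrC.
  apply: le_trans h; move: (r - _) (r - _) => v u; rewrite /Num.max.
  have [h1|h1] := ltP 0 u; have [h2|h2] := ltP 0 v; rewrite // ?subrr ?normr0 //.
    by rewrite !ger0_norm; lra.
  by rewrite !ler0_norm; lra.
have c13 : (1 : R) < 3 by lra.
exists (~` (p @` (box_dom b `&` [set z | `|z.1| <= 1 /\ `|z.2| <= 1]))).
  apply: open_nbhs_nbhs; split; first by apply: closed_openC; exact: box_core_closed.
  move=> [z [dz [z1 z2]] zs]; apply: nBs; rewrite -zs.
  by apply: (box_parP _).1; split=> //; split; lra.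
have b0 t : ~ (p @` (box_dom b `&` [set z | `|z.1| <= 1 /\ `|z.2| <= 1])) t -> box_bump t = 0.
  move=> nt; apply/eqP; rewrite eq_le box_bump_ge0 andbT leNgt; apply/negP.
  move=> /box_bump_support[Bt [k1 k2]]; have [[_ dk] pk] := box_coordP Bt.
  by apply: nt; exists (k t) => //; split=> //; split; exact: ltW.
by move=> s1 s2 /b0 -> /b0 ->; rewrite subrr normr0 mul1r.
Qed.

End OneBox.
End Boxes.

(** * Surfaces whose critical points are minima *)

Section LevelInduction.
Context {R : realType} {S : topologicalType} {V : normedModType R}.
Variables (x : S -> V) (phi : S -> R).
Hypotheses (hS : hausdorff_space S) (cS : compact [set: S]).
Hypotheses (cx : continuous x) (cphi : continuous phi).
Implicit Types (q s : S) (N : set S) (t : R).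

Let sub t : set S := [set s | phi s <= t].

Lemma sublevel_closed (G : S -> R) : continuous G -> closed [set s | phi s <= G s].
Proof.
move=> cG; have -> : [set s | phi s <= G s] = (fun s => phi s - G s) @^-1` [set t | t <= 0].
  by rewrite predeqE => s /=; rewrite subr_le0.
apply: preimage_closed; last exact: closed_le.
by move=> s _; apply: cvgB; [exact: cphi | exact: cG].
Qed.

Lemma sub_closed t : closed (sub t).
Proof. exact: (@sublevel_closed (fun=> t) (fun=> cvg_cst _)). Qed.

Section Chain.
Variable bx : S -> @box R S.

Let b q s : R := box_bump x q (bx q) s.
Let sumb (l : seq S) s : R := \sum_(q <- l) b q s.

Lemma sumb_continuous l : (forall q, q \in l -> box_at x phi q (bx q)) ->
  continuous (sumb l).
Proof.
elim: l => [_|q l IH ql] s.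
  rewrite /continuous_at /sumb big_nil.
  by under eq_fun do rewrite big_nil; exact: cvg_cst.
rewrite /continuous_at /sumb big_cons; under eq_fun do rewrite big_cons.
apply: cvgD; last by apply: IH => q' q'l; apply: ql; rewrite inE q'l orbT.
by apply: (locally_lipschitz_continuous cx (box_bump_lipschitz hS (ql q _))); rewrite inE eqxx.
Qed.

(** Raise the level by one bump after the other.  Every intermediate level has Lipschitz
    constant at most [M + eps * size l], so [box_push] applies at each step. *)
Lemma push_chain l N t2 eps M (H : S -> R) : 0 < eps -> 0 <= M ->
  locally_lipschitz x M H -> compact (N `&` sub t2) ->
  (forall q, q \in l -> [/\ box_at x phi q (bx q), box_rng (bx q) `<=` N &
     (M + eps * (size l)%:R) * box_slope (bx q) < 1]) ->
  homeomorphic (N `&` [set s | phi s <= Num.min t2 (H s)])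
               (N `&` [set s | phi s <= Num.min t2 (H s + eps * sumb l s)]).
Proof.
move=> e0; elim: l M H => [|q l IH] M H M0 lH cN lP.
  have -> : [set s | phi s <= Num.min t2 (H s + eps * sumb [::] s)] =
            [set s | phi s <= Num.min t2 (H s)].
    by apply/funext => s; rewrite /= /sumb big_nil mulr0 addr0.
  exact: homeomorphic_refl.
have [bq qN slq] := lP q (mem_head _ _).
pose H' s := H s + eps * b q s.
have lb : locally_lipschitz x eps (fun s => eps * b q s).
  exact: (locally_lipschitzZ (ltW e0) (box_bump_lipschitz hS bq)).
have lH' : locally_lipschitz x (M + eps) H' by exact: locally_lipschitzD.
have M1 : 0 <= M + eps by rewrite addr_ge0 // ltW.
have HH' s : H s <= H' s by rewrite lerDl mulr_ge0 ?box_bump_ge0 // ltW.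
have lHe : locally_lipschitz x (M + eps) H.
  apply/locally_lipschitzP => s; move/locally_lipschitzP: lH => /(_ s)[W nW lW].
  exists W => // s1 s2 W1 W2; apply: le_trans (lW s1 s2 W1 W2) _.
  by rewrite ler_wpM2r // lerDl ltW.
have l0 := locally_lipschitz_min t2 M1 lHe.
have l1 := locally_lipschitz_min t2 M1 lH'.
have step : homeomorphic (N `&` [set s | phi s <= Num.min t2 (H s)])
               (N `&` [set s | phi s <= Num.min t2 (H' s)]).
  apply: (box_push hS cx cphi bq l0 l1) => //.
  - apply: le_lt_trans slq; rewrite ler_wpM2r ?(ltW (box_slope_gt0 bq)) //.
    by rewrite lerD2l ler_peMr ?(ltW e0) // ler1n.
  - by move=> s; rewrite le_min ge_min lexx /= ge_min HH' orbT.
  - move=> s h; apply: (box_bump_support bq).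
    rewrite lt_neqAle box_bump_ge0 andbT; apply/eqP => b0.
    by move: h; rewrite /H' /b -b0 mulr0 addr0 ltxx.
  - have -> : N `&` [set s | phi s <= Num.min t2 (H s)] =
        (N `&` sub t2) `&` [set s | phi s <= Num.min t2 (H s)].
      rewrite predeqE => s; split=> [[Ns hs]|[[Ns _] hs]] //; split=> //; split=> //=.
      by apply: le_trans hs _; rewrite ge_min lexx.
    apply: compact_closedI => //.
    exact: sublevel_closed (locally_lipschitz_continuous cx l0).
apply: homeomorphic_trans step _.
have -> : [set s | phi s <= Num.min t2 (H s + eps * sumb (q :: l) s)] =
          [set s | phi s <= Num.min t2 (H' s + eps * sumb l s)].
  by apply/funext => s; rewrite /= /sumb big_cons /H' mulrDr addrA.
apply: (IH (M + eps) H' M1 lH' cN) => q' q'l.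
have [b' N' sl'] : [/\ box_at x phi q' (bx q'), box_rng (bx q') `<=` N &
     (M + eps * (size (q :: l))%:R) * box_slope (bx q') < 1].
  by apply: lP; rewrite inE q'l orbT.
by split=> //; move: sl'; rewrite /= -natr1 mulrDr mulr1 addrAC addrA.
Qed.

End Chain.

(** Compactness of the part of a level set lying in [N] turns the local pushes
    into a uniform statement about all nearby levels. *)
Lemma slab_homeo N T T' : T <= T' -> compact (N `&` sub T') ->
  (forall q, N q -> phi q = T ->
     exists2 b, box_at x phi q b & box_rng b `<=` N) ->
  exists2 d : R, 0 < d & forall t1 t2, T - d <= t1 -> t1 <= t2 -> t2 <= T + d ->
    t2 <= T' -> homeomorphic (N `&` sub t1) (N `&` sub t2).
Proof.
move=> TT' cN bN; pose C := (N `&` sub T') `&` [set s | phi s = T].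
have cC : compact C.
  apply: compact_closedI => //.
  have -> : [set s | phi s = T] = phi @^-1` [set T] by [].
  apply: preimage_closed => [s _|]; first exact: cphi.
  exact: closed_eq.
have /choice [bx bxP] : forall q, exists b, C q -> box_at x phi q b /\ box_rng b `<=` N.
  move=> q; have [[[Nq _] qT]|nC] := pselect (C q).
    by have [b bq bN'] := bN q Nq qT; exists b.
  by exists (@Box R S set0 set0 (fun=> q) (fun=> 0) 0 0).
have [q qC|l [lC lcov]] := @compact_finite_cover _ C
    (fun q => [set s | 0 < box_bump x q (bx q) s]) cC.
  have [bq _] := bxP q qC; split; last exact: box_bump_center bq.
  have cb := locally_lipschitz_continuous cx (box_bump_lipschitz hS bq).
  have -> : [set s | 0 < box_bump x q (bx q) s] =
      box_bump x q (bx q) @^-1` [set t | 0 < t] by [].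
  by apply: open_comp => [s _|]; [exact: cb | exact: open_gt].
have lbox q : q \in l -> box_at x phi q (bx q) by move=> /lC/bxP[].
pose sb s := \sum_(q <- l) box_bump x q (bx q) s.
have csb : continuous sb by exact: sumb_continuous.
have sb0 s : 0 <= sb s by apply: sumr_ge0 => q _; exact: box_bump_ge0.
have sbpos s : C s -> 0 < sb s.
  move=> /lcov[q ql /= bqs]; rewrite /sb (big_rem _ ql) /=.
  by apply: ltr_wpDr => //; apply: sumr_ge0 => q' _; exact: box_bump_ge0.
have [beta beta0 betaP] := compact_pos_lower_bound cC csb sbpos.
(* Where the bumps are small, [phi] stays away from [T]; so in a thin slab around
   [T] the bumps suffice to lift the lower level above the upper one. *)
pose K := (N `&` sub T') `&` [set s | sb s <= beta / 2].
have cK : compact K.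
  apply: compact_closedI => //.
  have -> : [set s | sb s <= beta / 2] = sb @^-1` [set t | t <= beta / 2] by [].
  by apply: preimage_closed => [s _|]; [exact: csb | exact: closed_le].
have [d0 d00 d0P] : exists2 d0, 0 < d0 & forall s, K s -> d0 <= `|phi s - T|.
  apply: (compact_pos_lower_bound cK).
    move=> s; apply: (@continuous_comp _ _ _ (fun s => phi s - T) (fun t => `|t|)).
      by apply: cvgB; [exact: cphi | exact: cvg_cst].
    exact: norm_continuous.
  move=> s [[Ns sT'] /= sbs]; rewrite normr_gt0 subr_eq0; apply/eqP => sT.
  have : beta <= sb s by exact: betaP.
  lra.
pose sl := \sum_(q <- l) box_slope (bx q).
have slq q : q \in l -> 0 < box_slope (bx q) <= sl.
  move=> ql; rewrite (box_slope_gt0 (lbox q ql)) /= /sl (big_rem _ ql) /= lerDl big_seq.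
  by apply: sumr_ge0 => q' /mem_rem /lbox /box_slope_gt0/ltW.
have sl0 : 0 <= sl by rewrite /sl big_seq; apply: sumr_ge0 => q /lbox /box_slope_gt0/ltW.
(* small enough for [eps * size l * box_slope < 1] in every box of the cover *)
pose eps := (1 + (size l)%:R * sl)^-1.
have den0 : 0 < 1 + (size l)%:R * sl by rewrite ltr_wpDr // mulr_ge0.
have eps0 : 0 < eps by rewrite invr_gt0.
exists (Num.min (d0 / 2) (eps * beta / 4)).
  by rewrite lt_min !divr_gt0 ?mulr_gt0.
set d := Num.min _ _ => t1 t2 t1T t12 t2T t2T'.
have dd0 : d <= d0 / 2 by rewrite ge_min lexx.
have deps : d <= eps * beta / 4 by rewrite ge_min lexx orbT.
have cN2 : compact (N `&` sub t2).
  have -> : N `&` sub t2 = (N `&` sub T') `&` sub t2.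
    rewrite predeqE => s; split=> [[Ns st]|[[Ns _] st]] //; split=> //; split=> //.
    exact: le_trans st t2T'.
  by apply: compact_closedI => //; exact: sub_closed.
have lc : locally_lipschitz x 0 (fun=> t1) by exact: locally_lipschitz_cst.
have [|f [g fgP]] := @push_chain bx l N t2 eps 0 (fun=> t1) eps0 (lexx _) lc cN2.
  move=> q ql; split; [exact: lbox | exact: (bxP q (lC q ql)).2 |].
  rewrite add0r -mulrA mulrC -/eps /eps ltr_pdivrMr // mul1r.
  apply: le_lt_trans (_ : (size l)%:R * sl < _); last by rewrite ltrDr.
  by rewrite ler_wpM2l //; case/andP: (slq q ql).
have e1 : N `&` [set s | phi s <= Num.min t2 t1] = N `&` sub t1.
  by rewrite (min_r t12).
have e2 : N `&` [set s | phi s <= Num.min t2 (t1 + eps * sb s)] = N `&` sub t2.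
  rewrite predeqE => s; split=> -[Ns /= h]; split=> //=.
    by move: h; rewrite le_min => /andP[].
  have {}h : phi s <= t2 := h; rewrite le_min h /=; have [|st1] := leP (phi s) t1.
    by move=> /le_trans; apply; rewrite lerDl mulr_ge0 // ltW.
  have [Ks|nK] := leP (sb s) (beta / 2).
    have : d0 <= `|phi s - T|.
      by apply: d0P; split=> //; split=> //; exact: le_trans h t2T'.
    rewrite ler_normr => /orP[|]; lra.
  have : eps * (beta / 2) <= eps * sb s by rewrite ler_pM2l // ltW.
  lra.
by rewrite -e1 -e2; exists f, g.
Qed.

Definition boxed q : Prop := forall N, open N -> N q ->
  exists2 b, box_at x phi q b & box_rng b `<=` N.

Definition disk : set 'rV[R]_2 := closed_eball 1.

(** The behaviour of [phi] at a nondegenerate local minimum, as far as the topology of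
    sublevel sets is concerned. *)
Definition centre q : Prop := exists D t,
  [/\ open D, D q, phi q < t & D `&` sub (phi q) = [set q]] /\
  closed (D `&` sub t) /\ homeomorphic (D `&` sub t) disk.

(** The second clause says that [U] is open in the sublevel set. *)
Definition disk_part t (U : set S) : Prop :=
  [/\ closed U, exists2 N, open N & U = N `&` sub t & homeomorphic U disk].

(** Every point of the disk is a limit of other points of the disk, on a radius. *)
Lemma disk_no_isolated_point U q D : homeomorphic U disk -> open D -> U q -> D q ->
  ~ (D `&` U `<=` [set q]).
Proof.
move=> [f [g [fP gP _ /within_continuousP cg]]] oD Uq Dq iso.
have [df gf] := fP q Uq.
pose w (a : R) : 'rV[R]_2 := if f q == 0 then a *: delta_mx 0 0 else (1 - a) *: f q.
have w0 : w 0 = f q.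
  by rewrite /w; case: eqP => [->|_]; rewrite ?scale0r ?subr0 ?scale1r.
have wneq (a : R) : 0 < a -> w a != f q.
  move=> a0; rewrite /w; case: (f q =P 0) => [->|/eqP fq0].
    rewrite scaler_eq0 negb_or (gt_eqF a0) /=; apply/eqP => /matrixP/(_ 0 0).
    by rewrite !mxE !eqxx => /eqP; rewrite oner_eq0.
  rewrite -subr_eq0 -{2}[f q]scale1r -scalerBl scaler_eq0 negb_or fq0 andbT.
  by apply: ltr0_neq0; lra.
have wd (a : R) : 0 <= a <= 1 -> disk (w a).
  move=> a01; rewrite /disk /w /closed_eball /=; case: eqP => _.
    by rewrite enormZ enorm_delta mulr1 ger0_norm; lra.
  rewrite enormZ ger0_norm; last by lra.
  have {}df : enorm (f q) <= 1 := df.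
  by apply: mulr_ile1 => //; [lra | exact: sqrtr_ge0 | lra].
have cw : {for 0, continuous w}.
  rewrite /continuous_at /w; case: eqP => _.
    by apply: cvgZr_tmp; exact: cvg_id.
  by apply: cvgZr_tmp; apply: cvgB; [exact: cvg_cst | exact: cvg_id].
have nD : nbhs (g (f q)) D by rewrite gf; exact: open_nbhs_nbhs.
have : nbhs (w 0) [set v | disk v -> D (g v)] by rewrite w0; exact: cg df _ nD.
move=> /cw/nbhs_ballP[e /= e0 eD].
pose a := Num.min 1 (e / 2).
have a0 : 0 < a by rewrite lt_min ltr01 divr_gt0.
have a1 : a <= 1 by rewrite ge_min lexx.
have ae : a <= e / 2 by rewrite ge_min lexx orbT.
have dw : disk (w a) by apply: wd; rewrite (ltW a0).
have Dgw : D (g (w a)).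
  by apply: (eD a) => //; rewrite /ball /= sub0r normrN gtr0_norm //; lra.
have [Ugw fgw] := gP _ dw.
by have /eqP[] := wneq a a0; rewrite -fgw (iso (g (w a))).
Qed.



Lemma box_below q b z : box_at x phi q b -> box_half b z -> forall W,
  nbhs (box_par b z) W -> exists2 s, W s & phi s < phi (box_par b z).
Proof.
move=> bq; case: z => a u Dz W nW.
have [[P Q] /= [nP /nbhs_ballP[e /= e0 Qe]] PQ] := box_par_near bq Dz nW.
have [[/= a3 u3] _] := Dz.
pose u' := Num.max (u - e / 2) ((u - 3) / 2).
have u'u : u' < u.
  by rewrite /u' gt_max; apply/andP; split; [lra | move: u3; rewrite ltr_norml; lra].
have u'e : u - e / 2 <= u' by rewrite /u' le_max lexx.
have u'3 : (u - 3) / 2 <= u' by rewrite /u' le_max lexx orbT.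
have D' : box_half b (a, u').
  apply: (box_down_half bq Dz) => /=; last exact: ltW.
  by split=> //=; move: u3; rewrite !ltr_norml; lra.
exists (box_par b (a, u')); last by case: (box_up bq D' Dz u'u).
apply: (PQ (a, u')) D'; split=> /=; first exact: nbhs_singleton.
by apply: Qe; rewrite /ball /= ltr_norml; lra.
Qed.

Lemma box_not_centre q b s : box_at x phi q b -> box_rng b s -> ~ centre s.
Proof.
move=> bq Bs [D [t [[oD Ds _ iso] _]]].
have [Dk pk] := box_coordP bq Bs.
have nD : nbhs (box_par b (box_coord b s)) D by rewrite pk; exact: open_nbhs_nbhs.
have [s' Ds' lt] := box_below bq Dk nD; rewrite pk in lt.
have : [set s] s' by rewrite -iso; split=> //; exact: ltW.
by move=> ss'; rewrite ss' ltxx in lt.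
Qed.

Hypothesis dichotomy : forall q, boxed q \/ centre q.

(** Without the minima at level [T], which are isolated in [{phi <= T}], the level has
    boxes everywhere, so [{phi <= t}] for [t] slightly below [T] is homeomorphic to
    [{phi <= T}] minus these minima, and its disk components are transported. *)
Lemma disk_part_limit T :
  (forall e : R, 0 < e -> exists2 t, T - e < t <= T & exists U, disk_part t U) ->
  exists U, disk_part T U.
Proof.
move=> lim; pose N := ~` [set s | centre s /\ phi s = T].
have clN : closed (N `&` sub T).
  rewrite -[X in closed X]setCK; apply: open_closedC.
  rewrite openE => s ns; rewrite /interior.
  have [sT|sT] := ltP T (phi s).
    have : nbhs s [set s' | T < phi s'] by apply: (cphi (t := [set t | T < t])); exact: lt_nbhsr.
    by apply: filterS => s' /= lt [_ s'T]; move: s'T; rewrite /sub /= leNgt lt.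
  have [[D [t [[oD Ds lt iso] cd]]] sT'] : centre s /\ phi s = T.
    by apply: contrapT => ns'; apply: ns; split.
  have : nbhs s D by exact: open_nbhs_nbhs.
  apply: filterS => s' Ds' [Ns' s'T]; apply: Ns'.
  have -> : s' = s.
    by have : [set s] s' by rewrite -iso sT'; split.
  by split=> //; exists D, t.
have cN : compact (N `&` sub T) by apply: subclosed_compact clN cS _ => ?.
have [d d0 slab] : exists2 d : R, 0 < d & forall t1 t2, T - d <= t1 -> t1 <= t2 ->
    t2 <= T + d -> t2 <= T -> homeomorphic (N `&` sub t1) (N `&` sub t2).
  apply: slab_homeo cN _ => // q Nq qT.
  have [/(_ setT openT I)[b bq _]|cq] := dichotomy q; last by case: Nq.
  by exists b => // s Bs [cs _]; exact: box_not_centre bq Bs cs.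
have [t /andP[tT1 tT2] [U [clU [N0 oN0 UE] hU]]] := lim d d0.
have [tT|tT] := eqVneq t T; first by exists U; split; rewrite -?tT //; exists N0; rewrite -?tT.
have tT' : t < T by rewrite lt_neqAle tT.
have subt : N `&` sub t = sub t.
  rewrite predeqE => s; split=> [[]//|st]; split=> // -[_ sT].
  by move: st; rewrite /sub /= sT leNgt tT'.
have := slab t T (ltW tT1) (ltW tT') _ (lexx _); rewrite subt lerDl (ltW d0).
move=> /(_ isT)[f [g [fP gP cf cg]]].
have U_sub : U `<=` sub t by rewrite UE => s [].
exists (f @` U); split.
- apply: compact_closed => //; apply: continuous_compact.
    exact: within_continuousS cf.
  by apply: subclosed_compact clU cS _.
- have cV : closed (f @` (sub t `\` U)).
    apply: compact_closed => //; apply: continuous_compact.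
      by apply: within_continuousS cf => s [].
    apply: (@subclosed_compact _ _ setT) => //.
    have -> : sub t `\` U = sub t `\` N0.
      rewrite predeqE => s; split=> -[st ns]; split=> // h; apply: ns.
        by rewrite UE.
      by move: h; rewrite UE => -[].
    by apply: closedI; [exact: sub_closed | exact: open_closedC].
  have oN : open N.
    rewrite openE => s Ns; rewrite /interior.
    have [sT|sT] := eqVneq (phi s) T.
      have [/(_ setT openT I)[b bs _]|cs] := dichotomy s; last by case: Ns.
      have [D0 p0] := box_center bs.
      have Bs : box_rng b s by rewrite -p0; exact: (box_parP bs D0).1.
      have : nbhs s (box_rng b) by apply: open_nbhs_nbhs; split=> //; exact: box_open bs.
      by apply: filterS => s' Bs' [cs' _]; exact: box_not_centre bs Bs' cs'.
    have oT : open (~` (phi @^-1` [set t | t = T])).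
      apply: closed_openC; apply: preimage_closed => [s' _|]; first exact: cphi.
      exact: closed_eq.
    have : nbhs s (~` (phi @^-1` [set t | t = T])).
      by apply: open_nbhs_nbhs; split=> //=; exact/eqP.
    by apply: filterS => s' /= s'T [].
  exists (N `&` ~` (f @` (sub t `\` U))).
    by apply: openI => //; exact: closed_openC.
  rewrite predeqE => s; split=> [[s' Us' <-]|[[Ns nV] sT]].
    have [[Nf fT] gf] := fP s' (U_sub _ Us'); split=> //; split=> //.
    move=> [s'' [ts'' nU] ff]; apply: nU.
    by have [_ gf''] := fP s'' ts''; rewrite -gf'' ff gf.
  have [tg fg] := gP s (conj Ns sT); exists (g s) => //.
  by apply: contrapT => nU; apply: nV; exists (g s).
- apply: (@homeomorphic_trans _ _ _ _ U) hU.
  apply: homeomorphic_sym; exists f, g; split.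
  + by move=> s Us; split; [exists s | exact: (fP s (U_sub _ Us)).2].
  + move=> s [s' Us' <-]; have [_ gf] := fP s' (U_sub _ Us').
    by rewrite gf.
  + exact: within_continuousS cf.
  + by apply: within_continuousS cg => s [s' Us' <-]; exact: (fP s' (U_sub _ Us')).1.
Qed.

(** Separate the disk from the rest of [{phi <= T}] by an open set [W] with
    [phi > T] on its frontier; then [W] stays a union of components for slightly larger
    levels, and it has no minimum at level [T]. *)
Lemma disk_part_extend T U : disk_part T U ->
  exists2 t, T < t & exists U', disk_part t U'.
Proof.
move=> [clU [N0 oN0 UE] hU].
have ot : open ([set s | T < phi s] `|` N0).
  apply: openU => //; have -> : [set s | T < phi s] = phi @^-1` [set t | T < t] by [].
  by apply: open_comp => [s _|]; [exact: cphi | exact: open_gt].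
have nt : set_nbhs U ([set s | T < phi s] `|` N0).
  move=> s Us; apply: open_nbhs_nbhs; split=> //.
  by move: Us; rewrite UE => -[? _]; right.
have [W0 UW0 W0t] := compact_normal hS cS clU nt.
pose W := W0°.
have oW : open W by exact: open_interior.
have UW : U `<=` W by move=> s /UW0.
have clW : closure W `<=` [set s | T < phi s] `|` N0.
  by apply: subset_trans W0t; apply: closure_subset; exact: interior_subset.
have cZ : compact (closure W `\` W).
  apply: (subclosed_compact _ cS) => //.
  by apply: closedI; [exact: closed_closure | exact: open_closedC].
have [d1 d10 d1P] : exists2 d1, 0 < d1 & forall s, (closure W `\` W) s -> d1 <= phi s - T.
  apply: (compact_pos_lower_bound cZ).
    by move=> s; apply: cvgB; [exact: cphi | exact: cvg_cst].
  move=> s [clWs nWs]; rewrite subr_gt0; case: (clW s clWs) => // N0s.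
  rewrite ltNge; apply/negP => sT; apply: nWs; apply: UW; rewrite UE; split=> //.
have subW t : t < T + d1 -> W `&` sub t = closure W `&` sub t.
  move=> tT; rewrite predeqE => s; split=> -[Ws st]; split=> //; first exact: subset_closure.
  apply: contrapT => nWs; have {}st : phi s <= t := st.
  have : d1 <= phi s - T by apply: d1P.
  lra.
have UW' : U = W `&` sub T.
  rewrite predeqE => s; split=> [Us|[Ws sT]].
    by split; [exact: UW | move: Us; rewrite UE => -[]].
  rewrite UE; split=> //; case: (clW s (subset_closure Ws)) => //= h.
  by move: sT; rewrite /sub /= leNgt h.
have cW : compact (W `&` sub (T + d1 / 2)).
  rewrite subW; last by lra.
  apply: (subclosed_compact _ cS) => //.
  by apply: closedI; [exact: closed_closure | exact: sub_closed].
have [d d0 slab] : exists2 d : R, 0 < d & forall t1 t2, T - d <= t1 -> t1 <= t2 ->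
    t2 <= T + d -> t2 <= T + d1 / 2 -> homeomorphic (W `&` sub t1) (W `&` sub t2).
  apply: slab_homeo cW _; first by lra.
  move=> q Wq qT; case: (dichotomy q) => [/(_ W oW Wq)//|[D [t [[oD Dq lt iso] _]]]].
  have Uq : U q by rewrite UW'; split=> //; rewrite /sub /= qT.
  case: (disk_no_isolated_point hU oD Uq Dq) => s [Ds Us].
  by rewrite -iso; split=> //; move: Us; rewrite UW' qT => -[].
pose t := T + Num.min d (d1 / 2).
have td : t <= T + d by rewrite lerD2l ge_min lexx.
have td1 : t <= T + d1 / 2 by rewrite lerD2l ge_min lexx orbT.
have Tt : T < t by rewrite ltrDl lt_min d0 divr_gt0.
exists t => //; exists (W `&` sub t); split.
- rewrite subW; last by lra.
  by apply: closedI; [exact: closed_closure | exact: sub_closed].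
- by exists W.
- apply: homeomorphic_trans hU; rewrite UW'; apply: homeomorphic_sym.
  by apply: slab => //; [lra | exact: ltW].
Qed.

(** The supremum of the levels with a disk component cannot be finite.  At a level above
    the maximum of [phi] such a component is open and closed in the whole space. *)
Theorem sublevel_disk : connected [set: S] -> [set: S] !=set0 ->
  homeomorphic [set: S] disk.
Proof.
move=> cn S0.
have [p _ pmin] := compact_EVT_min S0 cS (continuous_subspaceT cphi).
have [m _ mmax] := compact_EVT_max S0 cS (continuous_subspaceT cphi).
have [/(_ setT openT I)[b bp _]|[D [t0 [[oD Dp pt iso] [clD hD]]]]] := dichotomy p.
  have [D0 p0] := box_center bp.
  have [s _ lt] := box_below bp D0 (filterT : nbhs _ setT).
  by move: lt; rewrite p0 ltNge pmin ?inE.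
pose TT := [set t | exists U, disk_part t U].
have TT0 : TT t0 by exists (D `&` sub t0); split=> //; exists D.
have [t [U [clU [N oN UE] hU]] mt] : exists2 t, TT t & phi m < t.
  apply: contrapT => nex.
  have ub : has_ubound TT.
    exists (phi m) => t TTt; rewrite leNgt; apply/negP => mt; apply: nex.
    by exists t.
  have hs : has_sup TT by split=> //; exists t0.
  have [U0 U0P] : exists U, disk_part (sup TT) U.
    apply: disk_part_limit => e e0; have [t TTt et] := sup_adherent e0 hs.
    by exists t => //; rewrite et; exact: ub_le_sup.
  have [t lt TTt] := disk_part_extend U0P.
  by move: lt; rewrite ltNge; apply/negP; rewrite negbK; exact: ub_le_sup.
have subT : sub t = setT.
  by rewrite predeqE => s; split=> // _; apply: le_trans (ltW mt); apply: mmax; rewrite inE.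
suff <- : U = setT by [].
apply: cn.
- have [f [g [_ gP _ _]]] := hU; exists (g 0); apply: (gP 0 _).1.
  have := enormZ 0 (0 : 'rV[R]_2); rewrite scaler0 normr0 mul0r.
  by rewrite /disk /closed_eball /= => ->.
- by exists N => //; rewrite UE subT setIC.
- by exists U => //; rewrite setTI.
Qed.

End LevelInduction.

(** * Strict differentiability *)

Section Calculus.
Context {R : realType}.

Lemma derive_partials {n : nat} {V : normedModType R} (f : 'rV[R]_n -> V) u v :
  differentiable f u -> 'D_v f u = \sum_i v 0 i *: partial i f u.
Proof.
move=> df; rewrite deriveE // {1}[v]row_sum_delta linear_sum.
by apply: eq_bigr => i _; rewrite linearZ /partial deriveE.
Qed.

Lemma coord_partial {n m : nat} (c : 'rV[R]_n -> 'rV[R]_m) u j :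
  differentiable c u -> differentiable ((fun w => c w 0 j) : 'rV[R]_n -> R^o) u /\
  forall i, partial i ((fun w => c w 0 j) : 'rV[R]_n -> R^o) u = partial i c u 0 j.
Proof.
move=> dcu; split.
  apply: (@differentiable_comp _ _ _ R^o c (fun N : 'rV[R]_m => N 0 j : R^o) _ dcu).
  exact: differentiable_coord.
move=> i; rewrite /partial.
have dd : derivable c u (delta_mx 0 i) by exact: diff_derivable.
by rewrite (derive_mx dd) mxE.
Qed.

Lemma partial_dotv {n m : nat} (a b : 'rV[R]_n -> 'rV[R]_m) u :
  differentiable a u -> differentiable b u ->
  differentiable ((fun w => dotv (a w) (b w)) : 'rV[R]_n -> R^o) u /\
  forall i, partial i ((fun w => dotv (a w) (b w)) : 'rV[R]_n -> R^o) u =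
    dotv (partial i a u) (b u) + dotv (a u) (partial i b u).
Proof.
move=> da db.
have E : (fun w => dotv (a w) (b w)) =
    \sum_(j < m) ((fun w => a w 0 j) * (fun w => b w 0 j) : 'rV[R]_n -> R^o).
  by apply/funext => w; rewrite fct_sumE.
have dc (c : 'rV[R]_n -> 'rV[R]_m) j (dcu : differentiable c u) := (coord_partial j dcu).1.
have pc (c : 'rV[R]_n -> 'rV[R]_m) j (dcu : differentiable c u) := (coord_partial j dcu).2.
split; first by rewrite E; apply: differentiable_sum => j; apply: differentiableM; exact: dc.
move=> i; rewrite /partial E derive_sum; last first.
  by move=> j; apply: derivableM; apply: diff_derivable; exact: dc.
rewrite -big_split; apply: eq_bigr => j _.
rewrite deriveM; try (by apply: diff_derivable; exact: dc).
by rewrite -!/(partial i _ u) !pc // /GRing.scale /=; ring.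
Qed.

Lemma dotv_continuous {T : topologicalType} {m : nat} (a b : T -> 'rV[R]_m) s :
  {for s, continuous a} -> {for s, continuous b} ->
  {for s, continuous (fun w => dotv (a w) (b w))}.
Proof.
move=> ca cb; rewrite /continuous_at /dotv.
apply: (@cvg_big _ _ +%R 0 xpredT add_continuous) => i _.
have cc (c : T -> 'rV[R]_m) : {for s, continuous c} -> c w 0 i @[w --> s] --> c s 0 i.
  move=> cs; have := @continuous_comp _ _ _ c (fun N : 'rV[R]_m => N 0 i) s cs.
  by apply; exact: coord_continuous.
by apply: cvgM; exact: cc.
Qed.

Lemma segment_mvt {n : nat} (f : 'rV[R]_n -> R^o) w v :
  (forall t : R, 0 <= t <= 1 -> differentiable f (w + t *: v)) ->
  exists2 t : R, 0 < t < 1 &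
    f (w + v) - f w = \sum_i v 0 i * partial i f (w + t *: v).
Proof.
move=> df; pose m (t : R) : R^o := f (w + t *: v).
have dm (t : R) : 0 <= t <= 1 -> is_derive t 1 m ('D_v f (w + t *: v)).
  move=> t01; have : derivable f (w + t *: v) v by apply: diff_derivable; exact: df.
  have E : (fun h : R => h^-1 *: ((f \o shift (w + t *: v)) (h *: v) - f (w + t *: v))) =
           (fun h : R => h^-1 *: ((m \o shift t) (h *: 1) - m t)).
    apply/funext => h /=; congr (_ *: (f _ - _)).
    by rewrite /shift /= [h *: 1]mulr1 scalerDl addrCA.
  rewrite /derivable E => dmt; split=> //.
  by rewrite /derive E.
have cm : {within `[0, 1], continuous m}.
  apply: continuous_in_subspaceT => t; rewrite inE /= in_itv /= => t01.
  apply: differentiable_continuous; apply/derivable1_diffP.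
  by case: (dm t t01).
have dm' (t : R) : t \in `]0, 1[ -> is_derive t 1 m ('D_v f (w + t *: v)).
  by rewrite in_itv /= => /andP[t0 t1]; apply: dm; rewrite !ltW.
have [t t01 mt] := MVT ltr01 dm' cm; move: t01; rewrite in_itv /= => t01; exists t => //.
have := mt; rewrite /m scale1r scale0r addr0 subr0 mulr1 => ->.
by rewrite derive_partials //; apply: df; case/andP: t01 => /ltW -> /ltW ->.
Qed.

Lemma ball_segment {n : nat} (u0 u v : 'rV[R]_n) (rho t : R) : 0 <= t <= 1 ->
  `|u - u0| < rho -> `|v - u0| < rho -> `|v + t *: (u - v) - u0| < rho.
Proof.
move=> /andP[t0 t1] hu hv.
have -> : v + t *: (u - v) - u0 = t *: (u - u0) + (1 - t) *: (v - u0).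
  by apply/rowP => i; rewrite !mxE; ring.
apply: (le_lt_trans (ler_normD _ _)); rewrite !normrZ (ger0_norm t0) ger0_norm ?subr_ge0 //.
have [->|tn0] := eqVneq t 0; first by rewrite mul0r add0r subr0 mul1r.
have t00 : 0 < t by rewrite lt0r tn0.
have : t * `|u - u0| < t * rho by rewrite ltr_pM2l.
have : (1 - t) * `|v - u0| <= (1 - t) * rho by rewrite ler_wpM2l ?subr_ge0 // ltW.
lra.
Qed.

(** The covector [a] is meant to be the gradient of [f] at [u0], or that of a
    component of a vector-valued map. *)
Lemma increment_bound {n : nat} (f : 'rV[R]_n -> R^o) (a : 'I_n -> R) u0
    (rho eps : R) : 0 <= eps ->
  (forall w, `|w - u0| < rho ->
     differentiable f w /\ forall i, `|partial i f w - a i| <= eps) ->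
  forall u v, `|u - u0| < rho -> `|v - u0| < rho ->
    `|f u - f v - \sum_i (u - v) 0 i * a i| <= n%:R * eps * `|u - v|.
Proof.
move=> e0 fP u v ur vr; have [|t /andP[t0 t1]] := @segment_mvt n f v (u - v).
  by move=> t t01; case: (fP _ (ball_segment t01 ur vr)).
rewrite [v + (u - v)]addrC subrK => ->; rewrite -sumrB.
have t01 : 0 <= t <= 1 by rewrite !ltW.
have [_ dw] := fP _ (ball_segment t01 ur vr).
apply: (le_trans (ler_norm_sum _ _ _)).
apply: (@le_trans _ _ (\sum_(i < n) (`|u - v| * eps))).
  apply: ler_sum => i _; rewrite -mulrBr normrM.
  by apply: ler_pM => //; exact: coord_le_norm.
by rewrite sumr_const card_ord -[X in X <= _]mulr_natl; lra.
Qed.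

Lemma partials_near {n : nat} {V : normedModType R} (W : set 'rV[R]_n)
    (d : 'I_n -> 'rV[R]_n -> V) u0 (eps : R) :
  open W -> W u0 -> (forall i, {for u0, continuous (d i)}) -> 0 < eps ->
  exists2 rho : R, 0 < rho & forall w, `|w - u0| < rho ->
    W w /\ forall i, `|d i w - d i u0| <= eps.
Proof.
move=> oW Wu0 cd e0.
have : \forall u \near u0, W u /\ forall i, `|d i u0 - d i u| < eps.
  near=> u; split; first by near: u; exact: open_nbhs_nbhs.
  near: u; apply: filter_forall => i.
  by have /cvgrPdist_lt/(_ _ e0) := cd i.
move=> /nbhs_ballP[rho /= rho0 rhoP]; exists rho => // w wr.
have [|Ww dw] := rhoP w; first by rewrite mx_norm_ball /ball_ /= distrC.
by split=> // i; rewrite distrC ltW.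
Unshelve. all: by end_near. Qed.

(** On a small ball the partial derivatives are close to their values at [u0], and the
    mean value theorem applies to the segments of the ball.  Controlling increments
    between any two points, not only from [u0], is what the bounds along the lines of a
    box require. *)
Lemma strict_differentiability {n : nat} (W : set 'rV[R]_n) (f : 'rV[R]_n -> R^o)
    (d : 'I_n -> 'rV[R]_n -> R^o) u0 (eps : R) :
  open W -> W u0 -> (forall u, W u -> differentiable f u) ->
  (forall i u, W u -> partial i f u = d i u) ->
  (forall i, {for u0, continuous (d i)}) -> 0 < eps ->
  exists2 rho : R, 0 < rho & forall u v, `|u - u0| < rho -> `|v - u0| < rho ->
    `|f u - f v - \sum_i (u - v) 0 i * d i u0| <= eps * `|u - v|.
Proof.
move=> oW Wu0 df dE cd e0; have e1 : 0 < eps / (n%:R + 1) by rewrite divr_gt0 // ltr_wpDl.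
have [rho rho0 rhoP] := partials_near oW Wu0 cd e1; exists rho => // u v ur vr.
have n0 : (0 : R) <= n%:R by [].
apply: (le_trans (increment_bound (ltW e1) _ ur vr)) => [w wr|].
  by have [Ww dw] := rhoP w wr; split=> [|i]; [exact: df | rewrite dE].
by rewrite ler_wpM2r // mulrCA ler_piMr ?(ltW e0) // ler_pdivrMr; lra.
Qed.

Lemma strict_differentiability_row {n m : nat} (W : set 'rV[R]_n)
    (f : 'rV[R]_n -> 'rV[R]_m) u0 (eps : R) :
  open W -> W u0 -> (forall u, W u -> differentiable f u) ->
  (forall i, {for u0, continuous (partial i f)}) -> 0 < eps ->
  exists2 rho : R, 0 < rho & forall u v, `|u - u0| < rho -> `|v - u0| < rho ->
    `|f u - f v - (u - v) *m 'J f u0| <= eps * `|u - v|.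
Proof.
move=> oW Wu0 df cd e0; have e1 : 0 < eps / (n%:R + 1) by rewrite divr_gt0 // ltr_wpDl.
have [rho rho0 rhoP] := partials_near oW Wu0 cd e1; exists rho => // u v ur vr.
have n0 : (0 : R) <= n%:R by [].
rewrite -deriveEjacobian; last exact: df.
rewrite derive_partials; last exact: df.
apply: norm_le_coord => [|j]; first by rewrite mulr_ge0 // ltW.
rewrite !mxE summxE.
under [X in `|_ - X|]eq_bigr do rewrite mxE.
apply: le_trans (increment_bound (f := fun w => f w 0 j)
  (a := fun i => partial i f u0 0 j) (ltW e1) _ ur vr) _ => [w wr|].
  have [Ww dw] := rhoP w wr; have [dfj pfj] := coord_partial j (df w Ww).
  split=> // i; rewrite pfj; apply: le_trans (dw i).
  by have := coord_le_norm (partial i f w - partial i f u0) j; rewrite !mxE.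
by rewrite ler_wpM2r // mulrCA ler_piMr ?(ltW e0) // ler_pdivrMr; lra.
Qed.

End Calculus.

Lemma enorm_continuous {R : realType} {n : nat} : continuous (@enorm R n).
Proof.
move=> v; have c := @dotv_continuous R _ n id id v cvg_id cvg_id.
by apply: (continuous_comp c); exact: sqrt_continuous.
Qed.

(** * The squared norm of the position at noncritical points *)

(** The constant comes from a right inverse [K] of [J]. *)
Lemma row_free_lower_bound {R : realType} {m n : nat} (J : 'M[R]_(m, n)) :
  row_free J -> exists2 c : R, 0 < c & forall v : 'rV[R]_m, c * `|v| <= `|v *m J|.
Proof.
move=> /row_freeP[K JK]; pose C := \sum_i \sum_j `|K j i| + 1.
have K0 i : 0 <= \sum_j `|K j i| by apply: sumr_ge0.
have C0 : 0 < C by rewrite ltr_wpDl // sumr_ge0.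
exists C^-1; first by rewrite invr_gt0.
move=> v; rewrite -ler_pdivlMl ?invr_gt0 // invrK.
apply: norm_le_coord => [|i]; first by rewrite mulr_ge0 // ltW.
have -> : v 0 i = ((v *m J) *m K) 0 i by rewrite -mulmxA JK mulmx1.
rewrite mxE; apply: (le_trans (ler_norm_sum _ _ _)).
apply: (@le_trans _ _ ((\sum_j `|K j i|) * `|v *m J|)).
  rewrite mulr_suml; apply: ler_sum => j _; rewrite normrM mulrC ler_wpM2l //.
  exact: coord_le_norm.
rewrite ler_wpM2r // /C (bigD1 i) //= -addrA lerDl addr_ge0 //.
by apply: sumr_ge0 => k _; exact: K0.
Qed.

Lemma ord2_cases (i j k : 'I_2) : i != j -> k = i \/ k = j.
Proof.
case: i j k => [[|[|?]] ?] [[|[|?]] ?] [[|[|?]] ?] //= _;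
  by [left; apply: val_inj | right; apply: val_inj].
Qed.

Lemma sum_ord2 (V : nmodType) (F : 'I_2 -> V) : \sum_i F i = F 0 + F 1.
Proof.
rewrite !big_ord_recl big_ord0 addr0; congr (F _ + F _); exact: val_inj.
Qed.

Section ChartGeometry.
Context {R : realType} {n : nat} {S : topologicalType}.
Variables (x : S -> 'rV[R]_n) (phi : chart x).
Implicit Types (u v w xi eta : 'rV[R]_2) (s : S).

Let g := ext phi.
Let dom u := (cdom phi `&` half_plane) u.

Definition sqnorm s : R := dotv (x s) (x s).

(** Half the gradient of [|ext|^2]. *)
Definition half_grad (i : 'I_2) u : R := dotv (partial i g u) (g u).

Lemma ext_differentiable u : cdom phi u -> differentiable g u.
Proof. by case: (ext_smooth phi 1) => + _; apply. Qed.

Lemma partial_ext_differentiable i u : cdom phi u -> differentiable (partial i g) u.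
Proof. by case: (ext_smooth phi 2) => _ /(_ i) [+ _]; apply. Qed.

Lemma partial_ext_continuous i u : cdom phi u -> {for u, continuous (partial i g)}.
Proof. by case: (ext_smooth phi 1) => _ /(_ i); apply. Qed.

Lemma partial2_ext_continuous k i u : cdom phi u ->
  {for u, continuous (partial k (partial i g))}.
Proof. by case: (ext_smooth phi 2) => _ /(_ i) [_ /(_ k)]; apply. Qed.

Lemma ext_continuous u : cdom phi u -> {for u, continuous g}.
Proof. by move=> du; apply: differentiable_continuous; exact: ext_differentiable. Qed.

Lemma sqext_differentiable u : cdom phi u ->
  differentiable ((fun w => dotv (g w) (g w)) : 'rV[R]_2 -> R^o) u /\
  forall i, partial i ((fun w => dotv (g w) (g w)) : 'rV[R]_2 -> R^o) u =
    2 * half_grad i u.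
Proof.
move=> du; have [dd pd] := partial_dotv (ext_differentiable du) (ext_differentiable du).
by split=> // i; rewrite pd /half_grad (dotvC (g u)); ring.
Qed.

Lemma half_grad_continuous i u : cdom phi u -> {for u, continuous (half_grad i)}.
Proof.
move=> du; apply: dotv_continuous; first exact: partial_ext_continuous.
exact: ext_continuous.
Qed.

Lemma push_partials u xi : cdom phi u ->
  push phi u xi = \sum_i xi 0 i *: partial i g u.
Proof.
by move=> du; rewrite /push -deriveEjacobian ?derive_partials //;
   exact: ext_differentiable.
Qed.

Lemma push_half_grad u xi : cdom phi u ->
  dotv (push phi u xi) (g u) = \sum_i xi 0 i * half_grad i u.
Proof.
by move=> du; rewrite push_partials // dotv_suml; apply: eq_bigr => i _; rewrite dotvZl.
Qed.

Lemma sqext_sqnorm u : dom u -> dotv (g u) (g u) = sqnorm (par phi u).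
Proof. by move=> du; rewrite /sqnorm -extE. Qed.

Lemma par_near u (N : set S) : dom u -> nbhs (par phi u) N ->
  \forall u' \near u, dom u' -> N (par phi u').
Proof.
by move=> du; case: (chart_homeo phi) => _ _ /within_continuousP/(_ u du N).
Qed.

Lemma coord_near s (W : set 'rV[R]_2) : crng phi s -> nbhs (Defs.coord phi s) W ->
  \forall s' \near s, crng phi s' /\ W (Defs.coord phi s').
Proof.
move=> rs nW; case: (chart_homeo phi) => _ _ _ /within_continuousP/(_ s rs W nW) c.
have : nbhs s (crng phi) by apply: open_nbhs_nbhs; split=> //; exact: (@crng_open _ _ _ _ phi).
by apply: filterS2 c => s' h rs'; split=> //; exact: h.
Qed.

Lemma parP u : dom u -> crng phi (par phi u) /\ Defs.coord phi (par phi u) = u.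
Proof. by case: (chart_homeo phi) => + _ _ _; apply. Qed.

Lemma coordP s : crng phi s -> dom (Defs.coord phi s) /\ par phi (Defs.coord phi s) = s.
Proof. by case: (chart_homeo phi) => _ + _ _; apply. Qed.

Lemma nbhs_row_ball u (P : set 'rV[R]_2) : nbhs u P ->
  exists2 rho : R, 0 < rho & forall w, `|w - u| < rho -> P w.
Proof.
move=> /nbhs_ballP[rho /= r0 rP]; exists rho => // w h; apply: rP.
by rewrite mx_norm_ball /ball_ /= distrC.
Qed.

(** A noncritical point has a box.  Up to sign, [|ext|^2] increases in the direction of
    some coordinate [j]; at a boundary point this is the outward normal coordinate, so
    that the half plane cuts the box in its lower half. *)
Section Box.
Variables (u0 : 'rV[R]_2) (i j : 'I_2) (sg : R).
Hypotheses (du0 : dom u0) (ij : i != j) (sg1 : sg ^+ 2 = 1).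
Hypothesis slope : 0 < sg * half_grad j u0.
Hypothesis side : 0 < u0 0 1 \/ [/\ u0 0 1 = 0, j = 1 & sg = -1].

Let cu0 : cdom phi u0. Proof. by case: du0. Qed.

Let lin (l : R) (z : R * R) : 'rV[R]_2 :=
  u0 + (l * z.1) *: delta_mx 0 i + (l * sg * z.2) *: delta_mx 0 j.
Let lini (l : R) (u : 'rV[R]_2) : R * R :=
  ((u 0 i - u0 0 i) / l, sg * (u 0 j - u0 0 j) / l).

Let add_sub (p q : R) : p + q - p = q. Proof. by ring. Qed.

Let lin_i l z : lin l z 0 i = u0 0 i + l * z.1.
Proof. by rewrite !mxE !eqxx (negbTE ij) /=; ring. Qed.

Let lin_j l z : lin l z 0 j = u0 0 j + l * sg * z.2.
Proof. by rewrite !mxE !eqxx eq_sym (negbTE ij) /=; ring. Qed.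

Let linK l : l != 0 -> cancel (lin l) (lini l).
Proof.
move=> l0 [a b]; rewrite /lini lin_i lin_j /=; congr pair; first by field.
have -> : sg * (u0 0 j + l * sg * b - u0 0 j) / l = sg ^+ 2 * b by field.
by rewrite sg1 mul1r.
Qed.

Let liniK l : l != 0 -> cancel (lini l) (lin l).
Proof.
move=> l0 u; apply/rowP => k; case: (ord2_cases k ij) => ->.
  by rewrite lin_i /=; field.
rewrite lin_j /=; have -> : l * sg * (sg * (u 0 j - u0 0 j) / l) =
  sg ^+ 2 * (u 0 j - u0 0 j) by field.
by rewrite sg1; ring.
Qed.

Let sgn : `|sg| = 1.
Proof.
by apply/eqP; rewrite -(@eqrXn2 _ 2) // ?expr1n // -normrX sg1 normr1.
Qed.

Let lin_dist l z (c : R) : 0 < l -> square c z -> `|lin l z - u0| < l * c.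
Proof.
move=> l0 [z1 z2]; have c0 : 0 < c by exact: le_lt_trans z1.
apply: norm_lt_coord => [|k]; first by rewrite mulr_gt0.
have E v w (q : 'I_2) : (v - w : 'rV[R]_2) 0 q = v 0 q - w 0 q by rewrite !mxE.
rewrite E; case: (ord2_cases k ij) => ->; rewrite (lin_i, lin_j) add_sub.
  by rewrite normrM gtr0_norm // ltr_pM2l.
by rewrite !normrM sgn mulr1 gtr0_norm // ltr_pM2l.
Qed.

Let lin_dist_ge l z (c : R) : 0 < l -> ~ square c z -> l * c <= `|lin l z - u0|.
Proof.
move=> l0 nz; have E v w (q : 'I_2) : (v - w : 'rV[R]_2) 0 q = v 0 q - w 0 q by rewrite !mxE.
have [z1|z1] := ltP `|z.1| c.
  have z2 : c <= `|z.2| by rewrite leNgt; apply/negP => z2; apply: nz.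
  apply: le_trans (coord_le_norm _ j); rewrite E lin_j add_sub.
  by rewrite !normrM sgn mulr1 gtr0_norm // ler_pM2l.
apply: le_trans (coord_le_norm _ i); rewrite E lin_i add_sub.
by rewrite normrM gtr0_norm // ler_pM2l.
Qed.

Let lin_vertical l a t t' :
  lin l (a, t') - lin l (a, t) = (l * sg * (t' - t)) *: delta_mx 0 j.
Proof. by apply/rowP => k; rewrite !mxE /=; ring. Qed.

Let norm_delta : `|delta_mx 0 j : 'rV[R]_2| = 1.
Proof.
apply/eqP; rewrite eq_le; apply/andP; split.
  by apply: norm_le_coord => // k; rewrite mxE eqxx /=; case: eqP; rewrite ?normr1 ?normr0.
by have := coord_le_norm (delta_mx 0 j : 'rV[R]_2) j; rewrite mxE !eqxx normr1.
Qed.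

(** Strict differentiability of [|ext|^2] and of [ext] at [u0]. *)
Lemma chart_local_bounds : exists rho c C eta : R,
  [/\ 0 < rho, 0 < c, 0 < C & 0 < eta] /\
  [/\ forall l a t t', `|lin l (a, t) - u0| < rho -> `|lin l (a, t') - u0| < rho ->
        0 < l -> t < t' ->
        c * (l * (t' - t)) <= dotv (g (lin l (a, t'))) (g (lin l (a, t'))) -
                              dotv (g (lin l (a, t))) (g (lin l (a, t))),
      forall l a t t', `|lin l (a, t) - u0| < rho -> `|lin l (a, t') - u0| < rho ->
        0 < l -> t < t' ->
        `|g (lin l (a, t')) - g (lin l (a, t))| <= C * (l * (t' - t))
    & forall u, `|u - u0| < rho -> eta * `|u - u0| <= `|g u - g u0|].
Proof.
pose c0 := sg * half_grad j u0.
have dsq u : cdom phi u -> differentiable ((fun w => dotv (g w) (g w)) : _ -> R^o) u.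
  by move=> du; exact: (sqext_differentiable du).1.
have psq k u : cdom phi u -> partial k ((fun w => dotv (g w) (g w)) : _ -> R^o) u =
    2 * half_grad k u.
  by move=> du; exact: (sqext_differentiable du).2.
have csq k : {for u0, continuous ((fun w => 2 * half_grad k w) : _ -> R^o)}.
  exact: (cvgM (cvg_cst (2 : R)) (half_grad_continuous (i := k) cu0)).
have [rho1 r1 P1] := strict_differentiability (d := fun k w => 2 * half_grad k w)
  (@cdom_open _ _ _ _ phi) cu0 dsq psq csq slope.
have [c c_gt0 cJ] := row_free_lower_bound (ext_immersion du0).
have e0 : 0 < c / 2 by rewrite divr_gt0.
have [rho2 r2 P2] := strict_differentiability_row (@cdom_open _ _ _ _ phi) cu0
  ext_differentiable (fun k => partial_ext_continuous (i := k) cu0) e0.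
pose K := `|(delta_mx 0 j : 'rV[R]_2) *m 'J g u0|.
have K0 : 0 <= K by exact: normr_ge0.
exists (Num.min rho1 rho2), c0, (K + c / 2), (c / 2); split.
  by split=> //; [rewrite lt_min r1 | rewrite ltr_wpDl].
split.
- move=> l a t t'; rewrite !lt_min => /andP[h1 _] /andP[h2 _] l0 tt'.
  have lt0 : 0 < l * (t' - t) by rewrite mulr_gt0 ?subr_gt0.
  have := P1 _ _ h2 h1; rewrite lin_vertical normrZ norm_delta mulr1.
  have -> : \sum_k (l * sg * (t' - t) *: delta_mx 0 j : 'rV[R]_2) 0 k * (2 * half_grad k u0)
     = 2 * c0 * (l * (t' - t)).
    rewrite (bigD1 j) //= big1 ?addr0.
      by rewrite !mxE !eqxx /c0 /=; ring.
    by move=> k kj; rewrite !mxE (negbTE kj) andbF mulr0 mul0r.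
  have -> : `|l * sg * (t' - t)| = l * (t' - t).
    by rewrite !normrM sgn mulr1 !gtr0_norm // subr_gt0.
  rewrite ler_norml -/c0 => /andP[h _]; lra.
- move=> l a t t'; rewrite !lt_min => /andP[_ h1] /andP[_ h2] l0 tt'.
  have lt0 : 0 < l * (t' - t) by rewrite mulr_gt0 ?subr_gt0.
  have := P2 _ _ h2 h1; rewrite lin_vertical -scalemxAl normrZ norm_delta mulr1.
  have nn : `|l * sg * (t' - t)| = l * (t' - t).
    by rewrite !normrM sgn mulr1 !gtr0_norm // subr_gt0.
  rewrite nn; set A := g _ - g _; set B := _ *: _ => h.
  have : `|A| <= `|A - B| + `|B| by rewrite -{1}(subrK B A) ler_normD.
  have -> : `|B| = K * (l * (t' - t)) by rewrite normrZ nn mulrC.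
  rewrite mulrDl; lra.
- move=> u; rewrite lt_min => /andP[_ h].
  have := P2 _ _ h (_ : `|u0 - u0| < rho2); rewrite subrr normr0 => /(_ r2).
  have := cJ (u - u0); set A := g _ - g _; set B := _ *m _ => h1 h2.
  have : `|B| <= `|A - B| + `|A| by rewrite -{1}(subKr A B) [leRHS]addrC ler_normB.
  lra.
Qed.

Let lin_continuous l : continuous (lin l).
Proof.
move=> z; have c1 : l * y.1 @[y --> z] --> l * z.1.
  by apply: cvgM; [exact: cvg_cst | exact: cvg_fst].
have c2 : l * sg * y.2 @[y --> z] --> l * sg * z.2.
  by apply: cvgM; [exact: cvg_cst | exact: cvg_snd].
exact: (cvgD (cvgD (cvg_cst _) (cvgZ c1 (cvg_cst _))) (cvgZ c2 (cvg_cst _))).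
Qed.

Let lini_continuous l : continuous (lini l).
Proof.
move=> u.
have cc (k : 'I_2) : (fun w : 'rV[R]_2 => w 0 k - u0 0 k) @ u --> u 0 k - u0 0 k.
  exact: (cvgB (@coord_continuous R 1 2 0 k u) (cvg_cst _)).
have c1 : (fun w => (lini l w).1) @ u --> (lini l u).1.
  exact: (cvgM (cc i) (cvg_cst l^-1)).
have c2 : (fun w => (lini l w).2) @ u --> (lini l u).2.
  exact: (cvgM (cvgM (cvg_cst sg) (cc j)) (cvg_cst l^-1)).
exact: (cvg_pair c1 c2).
Qed.

Let square_open (c : R) : open (square c).
Proof.
have cn (f : R * R -> R) : continuous f -> open [set z | `|f z| < c].
  move=> cf; have -> : [set z | `|f z| < c] = (fun z => `|f z|) @^-1` [set t | t < c] by [].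
  apply: open_comp => [z _|]; last exact: open_lt.
  by apply: (continuous_comp (cf z)); exact: norm_continuous.
have -> : square c = [set z | `|z.1| < c] `&` [set z | `|z.2| < c] by rewrite predeqE.
by apply: openI; apply: cn => z; [exact: cvg_fst | exact: cvg_snd].
Qed.

Lemma chart_boxed : boxed x sqnorm (par phi u0).
Proof.
move=> N oN Nq; have [rho [c [C [eta [[r0 c0 C0 eta0] [B1 B2 B3]]]]]] := chart_local_bounds.
have [rho2 r20 P2] : exists2 rho2 : R, 0 < rho2 & forall u, `|u - u0| < rho2 ->
    [/\ cdom phi u, dom u -> N (par phi u) & 0 < u0 0 1 -> 0 < u 0 1].
  apply: nbhs_row_ball.
  have n1 : \forall u \near u0, cdom phi u.
    by apply: open_nbhs_nbhs; split=> //; exact: (@cdom_open _ _ _ _ phi).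
  have n2 : \forall u \near u0, dom u -> N (par phi u).
    by apply: par_near => //; exact: open_nbhs_nbhs.
  have n3 : nbhs u0 [set u : 'rV[R]_2 | 0 < u0 0 1 -> 0 < u 0 1].
    have [u01|u01] := ltP 0 (u0 0 1); last first.
      by apply: filterS filterT => u _.
    have : nbhs u0 [set u : 'rV[R]_2 | 0 < u 0 1].
      apply: (@coord_continuous R 1 2 0 1 u0 [set t | 0 < t]).
      exact: lt_nbhsr.
    by apply: filterS => u /= ? _.
  by apply: filterS3 n1 n2 n3 => u ? ? ?; split.
pose l := Num.min rho rho2 / 3.
have l0 : 0 < l by rewrite divr_gt0 // lt_min r0.
have ln0 := lt0r_neq0 l0.
have l3 : l * 3 = Num.min rho rho2 by rewrite /l divfK.
have inr z : square 3 z -> `|lin l z - u0| < rho /\ `|lin l z - u0| < rho2.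
  move=> /(lin_dist l0); rewrite l3 lt_min => /andP[]; by [].
have lin0 : lin l (0, 0) = u0 by rewrite /lin /= !mulr0 !scale0r !addr0.
have linj a t : lin l (a, t) 0 1 = if j == 1 then u0 0 1 + l * sg * t else u0 0 1 + l * a.
  case: eqVneq => [j1|j1]; first by rewrite -j1 lin_j.
  by have [->|j1'] := ord2_cases 1 ij; [rewrite lin_i | rewrite j1' eqxx in j1].
pose b := @Box R S [set z | half_plane (lin l z)]
  [set s | crng phi s /\ square 3 (lini l (Defs.coord phi s))]
  (par phi \o lin l) (lini l \o Defs.coord phi) (C / c) (eta * l).
have bh z : box_half b z -> dom (lin l z).
  by move=> [s3 /= hz]; split=> //; case: (P2 _ (inr z s3).2).
have rngP s : box_rng b s -> box_half b (box_coord b s) /\ box_par b (box_coord b s) = s.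
  move=> [rs s3]; have [dk pk] := coordP rs.
  by rewrite /= liniK //; split=> //; split=> //=; rewrite liniK //; case: dk.
exists b; last first.
  move=> s bs; have [hb <-] := rngP s bs; have [s3 _] := hb.
  by case: (P2 _ (inr _ s3).2) => _ + _; apply; exact: bh.
split.
- have -> : box_dom b = (fun z => lin l z 0 1) @^-1` [set t | 0 <= t] by [].
  apply: preimage_closed => [z _|]; last exact: closed_ge.
  apply: (@continuous_comp _ _ _ (lin l) (fun w : 'rV[R]_2 => w 0 1)).
    exact: lin_continuous.
  exact: coord_continuous.
- move=> [a t] [a' t'] /= hz s3 tt'; case: side => [u01|[u01 j1 sgm]].
    by case: (P2 _ (inr _ s3).2) => _ _ /(_ u01) /ltW.
  move: hz; rewrite /half_plane /= !linj j1 eqxx u01 sgm.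
  rewrite mulrN1 !mulNr !add0r !oppr_ge0 !pmulr_rle0 //.
  exact: le_trans.
- rewrite openE => s [rs s3]; rewrite /interior.
  have : nbhs (Defs.coord phi s) (lini l @^-1` square 3).
    by apply: lini_continuous; apply: open_nbhs_nbhs; split=> //; exact: square_open.
  exact: coord_near.
- split.
  + move=> z hz; have [rp cp] := parP (bh z hz).
    by split; [split=> //; rewrite cp linK //; case: hz | rewrite /= cp linK].
  + by move=> s bs; exact: rngP.
  + apply/within_continuousP => z hz W nW.
    have c1 : nbhs z (lin l @^-1` (fun u' => dom u' -> W (par phi u'))).
      exact: lin_continuous (par_near (bh z hz) nW).
    by apply: (filterS _ c1) => z' h hz'; exact: (h (bh z' hz')).
  + apply/within_continuousP => s [rs s3] W nW.
    have c1 := coord_near rs (lini_continuous nW : nbhs _ (lini l @^-1` W)).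
    by apply: (filterS _ c1) => s' [_ h] _.
- split; last by rewrite /= lin0.
  split; first by split; rewrite /= normr0.
  by rewrite /= lin0; case: du0.
- exact: divr_gt0.
- exact: mulr_gt0.
- move=> a t t' ht ht' tt' /=.
  have [s3 _] := ht; have [s3' _] := ht'.
  have dt := bh _ ht; have dt' := bh _ ht'.
  rewrite -!sqext_sqnorm // -!extE // -/g.
  have h1 := B1 l a t t' (inr _ s3).1 (inr _ s3').1 l0 tt'.
  have h2 := B2 l a t t' (inr _ s3).1 (inr _ s3').1 l0 tt'.
  have lt0 : 0 < l * (t' - t) by rewrite mulr_gt0 ?subr_gt0.
  split; first by rewrite -subr_gt0; apply: lt_le_trans h1; rewrite mulr_gt0.
  apply: le_trans h2 _; by rewrite -mulrA ler_pM2l // ler_pdivlMl.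
- move=> z hz nz /=; have [s3 _] := hz; have dz := bh _ hz.
  rewrite -!extE // -/g; apply: le_trans (B3 _ (inr z s3).1).
  by rewrite ler_pM2l //; have := lin_dist_ge l0 nz; rewrite mulr1.
Unshelve. all: by end_near. Qed.

End Box.
End ChartGeometry.

(** * The Hessian of the squared norm *)

(** A gradient that is strongly monotone towards [u0] makes [f] grow along rays, by the
    mean value theorem on the part of the ray from [t] to [1]. *)
Lemma radial_growth {R : realType} {n : nat} (f : 'rV[R]_n -> R^o)
    (d : 'I_n -> 'rV[R]_n -> R) u0 (rho kappa : R) : 0 < kappa ->
  (forall w, `|w - u0| < rho ->
     differentiable f w /\ forall i, partial i f w = d i w) ->
  (forall w, `|w - u0| < rho ->
     kappa * `|w - u0| ^+ 2 <= \sum_i (w - u0) 0 i * d i w) ->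
  forall u (t : R), `|u - u0| < rho -> u != u0 -> 0 <= t < 1 ->
    kappa * (t * (1 - t) * `|u - u0| ^+ 2) < f u - f (u0 + t *: (u - u0)).
Proof.
move=> k0 fP dP u t ur uu0 /andP[t0 t1].
have rho0 : 0 < rho by exact: le_lt_trans ur.
have u0r : `|u0 - u0| < rho by rewrite subrr normr0.
have E s : u0 + t *: (u - u0) + s *: ((1 - t) *: (u - u0)) =
    u0 + (t + s * (1 - t)) *: (u - u0).
  by apply/rowP => i; rewrite !mxE; ring.
have inr s : 0 <= s <= 1 -> `|u0 + (t + s * (1 - t)) *: (u - u0) - u0| < rho.
  move=> /andP[s0 s1]; apply: ball_segment => //; apply/andP; split.
    by rewrite addr_ge0 // mulr_ge0 // subr_ge0 ltW.
  have : s * (1 - t) <= 1 - t by rewrite ler_piMl // subr_ge0 ltW.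
  lra.
have [s s01|s /andP[s0 s1]] := @segment_mvt _ _ f (u0 + t *: (u - u0)) ((1 - t) *: (u - u0)).
  by rewrite E; exact: (fP _ (inr s s01)).1.
have -> : u0 + t *: (u - u0) + (1 - t) *: (u - u0) = u.
  by apply/rowP => i; rewrite !mxE; ring.
have s01 : 0 <= s <= 1 by rewrite !ltW.
rewrite E => ->; set tau := t + s * (1 - t).
have st : t < tau by rewrite ltrDl mulr_gt0 ?subr_gt0.
have tau0 : 0 < tau by exact: le_lt_trans st.
have := dP _ (inr s s01); rewrite -/tau.
have -> : u0 + tau *: (u - u0) - u0 = tau *: (u - u0) by rewrite addrC addKr.
rewrite normrZ gtr0_norm // => h.
have N0 : 0 < `|u - u0| by rewrite normr_gt0 subr_eq0.
pose D := \sum_i (u - u0) 0 i * d i (u0 + tau *: (u - u0)).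
have hD : \sum_i (tau *: (u - u0)) 0 i * d i (u0 + tau *: (u - u0)) = tau * D.
  by rewrite mulr_sumr; apply: eq_bigr => i _; rewrite mxE mulrA.
have -> : \sum_i ((1 - t) *: (u - u0)) 0 i * partial i f (u0 + tau *: (u - u0)) = (1 - t) * D.
  rewrite mulr_sumr; apply: eq_bigr => i _.
  by rewrite (fP _ (inr s s01)).2 mxE mulrA.
move: h; rewrite hD => h.
have hD' : kappa * (tau * `|u - u0| ^+ 2) <= D.
  by rewrite -(ler_pM2l tau0); apply: le_trans h; rewrite le_eqVlt; apply/orP; left; apply/eqP; ring.
have -> : kappa * (t * (1 - t) * `|u - u0| ^+ 2) =
   (1 - t) * (kappa * (t * `|u - u0| ^+ 2)) by ring.
rewrite ltr_pM2l ?subr_gt0 //; apply: lt_le_trans hD'.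
by rewrite ltr_pM2l // ltr_pM2r // exprn_gt0.
Qed.

Section ChartHessian.
Context {R : realType} {n : nat} {S : topologicalType}.
Variables (x : S -> 'rV[R]_n) (phi : chart x).
Implicit Types (u v w xi eta : 'rV[R]_2) (s : S).

Let g := ext phi.
Let dom u := (cdom phi `&` half_plane) u.
Let hg := half_grad phi.

(** Half the Hessian of [|ext|^2]. *)
Definition half_hess (k i : 'I_2) u : R :=
  dotv (partial k (partial i g) u) (g u) + dotv (partial i g u) (partial k g u).

Lemma half_grad_differentiable i u : cdom phi u ->
  differentiable (hg i : _ -> R^o) u /\
  forall k, partial k (hg i : _ -> R^o) u = half_hess k i u.
Proof.
move=> du.
by have [] := partial_dotv (partial_ext_differentiable i du) (ext_differentiable du).
Qed.

Lemma half_hess_continuous k i u : cdom phi u -> {for u, continuous (half_hess k i)}.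
Proof.
move=> du.
have c1 := dotv_continuous (partial2_ext_continuous (k := k) (i := i) du) (ext_continuous du).
have c2 := dotv_continuous (partial_ext_continuous (i := i) du)
                           (partial_ext_continuous (i := k) du).
exact: (cvgD c1 c2).
Qed.

Lemma increase_along u0 v : cdom phi u0 -> 0 < \sum_i v 0 i * hg i u0 ->
  exists2 rho : R, 0 < rho & forall t : R, 0 < t < rho ->
    dotv (g u0) (g u0) < dotv (g (u0 + t *: v)) (g (u0 + t *: v)).
Proof.
move=> du0; set a := \sum_i _ => a0.
have v0 : 0 < `|v|.
  rewrite normr_gt0; apply: contraTneq a0 => v0.
  by rewrite /a v0 big1 ?ltxx // => i _; rewrite mxE mul0r.
have e0 : 0 < a / `|v| by rewrite divr_gt0.
have [rho r0 P] := strict_differentiability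
  (d := fun k w => 2 * hg k w) (f := fun w => dotv (g w) (g w))
  (@cdom_open _ _ _ _ phi) du0 (fun u du => (sqext_differentiable du).1)
  (fun k u du => (sqext_differentiable du).2 k)
  (fun k => cvgM (cvg_cst (2 : R)) (half_grad_continuous (i := k) du0)) e0.
exists (rho / `|v|); first by rewrite divr_gt0.
move=> t /andP[t0 tr].
have := P (u0 + t *: v) u0; rewrite subrr normr0 => /(_ _ r0).
have -> : u0 + t *: v - u0 = t *: v by rewrite addrC addKr.
rewrite normrZ gtr0_norm // -ltr_pdivlMr // => /(_ tr).
have -> : \sum_i (t *: v) 0 i * (2 * hg i u0) = 2 * t * a.
  by rewrite mulr_sumr; apply: eq_bigr => i _; rewrite mxE; ring.
have -> : a / `|v| * (t * `|v|) = a * t by field; exact: lt0r_neq0.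
rewrite ler_norml => /andP[h _].
have : 0 < a * t by rewrite mulr_gt0.
lra.
Qed.

(** Strict differentiability of the gradient at [u0] turns the bound on the Hessian at
    the point into monotonicity of the gradient around it. *)
Lemma convex_near_critical u0 (kappa : R) : dom u0 -> (forall i, hg i u0 = 0) ->
  0 < kappa ->
  (forall w, kappa * `|w| ^+ 2 <= \sum_i \sum_k w 0 i * w 0 k * half_hess k i u0) ->
  exists2 rho : R, 0 < rho & forall w, `|w - u0| < rho ->
    kappa * `|w - u0| ^+ 2 <= \sum_i (w - u0) 0 i * (2 * hg i w).
Proof.
move=> [du0 _] crit k0 hess; have e0 : 0 < kappa / 4 by rewrite divr_gt0.
have sd i := strict_differentiability (d := fun k w => half_hess k i w)
  (@cdom_open _ _ _ _ phi) du0 (fun u du => (half_grad_differentiable i du).1)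
  (fun k u du => (half_grad_differentiable i du).2 k)
  (fun k => half_hess_continuous (k := k) (i := i) du0) e0.
have [r1 r10 P1] := sd 0; have [r2 r20 P2] := sd 1.
exists (Num.min r1 r2); first by rewrite lt_min r10.
move=> w; rewrite lt_min => /andP[w1 w2].
have P i : `|hg i w - \sum_k (w - u0) 0 k * half_hess k i u0| <= kappa / 4 * `|w - u0|.
  case: (ord2_cases i (isT : (0 : 'I_2) != 1)) => ->.
    by have := P1 w u0 w1; rewrite subrr normr0 crit subr0; apply.
  by have := P2 w u0 w2; rewrite subrr normr0 crit subr0; apply.
have h0 := hess (w - u0).
have : \sum_i (w - u0) 0 i * hg i w >= \sum_i (\sum_k (w - u0) 0 i * (w - u0) 0 k * half_hess k i u0
   - kappa / 4 * `|w - u0| ^+ 2).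
  apply: ler_sum => i _.
  have -> : \sum_k (w - u0) 0 i * (w - u0) 0 k * half_hess k i u0 =
    (w - u0) 0 i * \sum_k (w - u0) 0 k * half_hess k i u0.
    by rewrite mulr_sumr; apply: eq_bigr => k _; rewrite mulrA.
  rewrite lerBlDr -lerBlDl -mulrBr; apply: le_trans (ler_norm _) _.
  rewrite normrM expr2 mulrA [X in _ <= X]mulrC; apply: ler_pM => //.
    exact: coord_le_norm.
  by rewrite distrC.
rewrite big_split /= sumrN sumr_const card_ord -[(_ * _) *+ 2]mulr_natl.
have -> : \sum_i (w - u0) 0 i * (2 * hg i w) = 2 * \sum_i (w - u0) 0 i * hg i w.
  by rewrite mulr_sumr; apply: eq_bigr => i _; ring.
lra.
Qed.

Lemma sff_bilinear u (a : R) xi : sff phi u (a *: xi) (a *: xi) = a ^+ 2 *: sff phi u xi xi.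
Proof.
rewrite /sff scaler_sumr; apply: eq_bigr => i _; rewrite scaler_sumr; apply: eq_bigr => j _.
by rewrite !mxE scalerA; congr (_ *: _); ring.
Qed.

Lemma push_dotv_gt0 u xi : dom u -> xi != 0 -> 0 < dotv (push phi u xi) (push phi u xi).
Proof.
move=> du xi0; apply: dotv_gt0; apply: contra_neq xi0 => p0.
have := row_freeP (ext_immersion du) => -[K JK].
by rewrite -[xi]mulmx1 -JK mulmxA -/(push phi u xi) p0 mul0mx.
Qed.

Lemma pushZ u (a : R) xi : push phi u (a *: xi) = a *: push phi u xi.
Proof. by rewrite /push scalemxAl. Qed.

(** Rotate the covector [<., push xi>] by a right angle. *)
Lemma orthogonal_direction u xi : dom u -> xi != 0 ->
  exists2 eta, eta != 0 & dotv (push phi u eta) (push phi u xi) = 0.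
Proof.
move=> du xi0; have cu : cdom phi u by case: du.
have pos := push_dotv_gt0 du xi0; set w := push phi u xi in pos *.
have : forall zeta, push phi u zeta = zeta 0 0 *: partial 0 g u + zeta 0 1 *: partial 1 g u.
  by move=> zeta; rewrite push_partials // sum_ord2.
move: (partial 0 g u) (partial 1 g u) => p0 p1 pushE.
pose a := dotv p0 w; pose b := dotv p1 w.
have dpush zeta : dotv (push phi u zeta) w = zeta 0 0 * a + zeta 0 1 * b.
  by rewrite pushE dotvDl !dotvZl.
pose eta : 'rV[R]_2 := \row_i (if i == 0 then b else - a).
have eta00 : eta 0 0 = b by rewrite mxE.
have eta01 : eta 0 1 = - a by rewrite mxE.
exists eta; last by rewrite dpush eta00 eta01; ring.
apply: contraTneq pos => /rowP eta0; rewrite dpush.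
have := eta0 0; have := eta0 1; rewrite eta00 eta01 !mxE => /eqP.
by rewrite oppr_eq0 => /eqP -> ->; rewrite !mulr0 addr0 ltxx.
Qed.

(** [sff_normsq] is only known for orthonormal frames, so [xi] is completed to such a
    frame; the term [A(e_1, e_1)] of the sum is the one that is kept. *)
Lemma sff_bound u xi (b : R) : dom u ->
  (forall e, orthonormal_frame phi u e -> sff_normsq phi u e <= b ^+ 2) -> 0 <= b ->
  enorm (sff phi u xi xi) <= b * dotv (push phi u xi) (push phi u xi).
Proof.
move=> du bP b0; have [->|xi0] := eqVneq xi 0.
  have := sff_bilinear u 0 0; rewrite scaler0 expr0n /= scale0r => ->.
  by rewrite /push mul0mx dotv0l mulr0 /enorm dotv0l sqrtr0.
have cu : cdom phi u by case: du.
have [eta eta0 eta_perp] := orthogonal_direction du xi0.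
have P0 := push_dotv_gt0 du xi0; set P := dotv _ _ in P0 *.
have Q0 := push_dotv_gt0 du eta0; set Q := dotv _ _ in Q0 *.
pose e1 := (Num.sqrt P)^-1 *: xi; pose e2 := (Num.sqrt Q)^-1 *: eta.
pose e : 'M[R]_2 := \matrix_(i, j) (if i == 0 then e1 0 j else e2 0 j).
have re0 : row 0 e = e1 by apply/rowP => j; rewrite !mxE.
have re1 : row 1 e = e2 by apply/rowP => j; rewrite !mxE.
have unit (A : R) : 0 < A -> (Num.sqrt A)^-1 * ((Num.sqrt A)^-1 * A) = 1.
  move=> A0; rewrite mulrA -expr2 exprVn sqr_sqrtr ?(ltW A0) //.
  by rewrite mulVf // lt0r_neq0.
have fe : orthonormal_frame phi u e.
  move=> i j; case: (ord2_cases i (isT : (0 : 'I_2) != 1)) => ->;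
    case: (ord2_cases j (isT : (0 : 'I_2) != 1)) => ->;
    rewrite ?re0 ?re1 !pushZ !(dotvZl, dotvZr) /=.
  - exact: unit.
  - by rewrite dotvC eta_perp !mulr0.
  - by rewrite eta_perp !mulr0.
  - exact: unit.
have := bP e fe; rewrite /sff_normsq !sum_ord2 re0 => h.
have {h} : enorm (sff phi u e1 e1) ^+ 2 <= b ^+ 2.
  apply: le_trans h; rewrite -!addrA lerDl !addr_ge0 ?sqr_ge0 //.
rewrite ler_sqr ?nnegrE ?enorm_ge0 // sff_bilinear enormZ exprVn sqr_sqrtr ?(ltW P0) //.
by rewrite ger0_norm ?invr_ge0 ?(ltW P0) // mulrC ler_pdivrMr.
Qed.

(** At a critical point of [|x|^2] the position is normal, so the Christoffel
    terms of [A] drop out and the Hessian of [|x|^2 / 2] is the metric plus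
    [<A(.,.), x>]; the bounds on [A] and on [|x|] make it definite. *)
Lemma half_hess_lower_bound u0 (r : R) : dom u0 -> 0 < r ->
  (forall i, hg i u0 = 0) -> enorm (g u0) < r ->
  (forall e, orthonormal_frame phi u0 e -> sff_normsq phi u0 e <= 1 / r ^+ 2) ->
  exists2 kappa : R, 0 < kappa & forall w,
    kappa * `|w| ^+ 2 <= \sum_i \sum_k w 0 i * w 0 k * half_hess k i u0.
Proof.
move=> du0 r0 crit gr hA; have cu0 : cdom phi u0 by case: du0.
have [c c0 cJ] := row_free_lower_bound (ext_immersion du0).
have lam0 : 0 < 1 - enorm (g u0) / r by rewrite subr_gt0 ltr_pdivrMr ?mul1r.
exists ((1 - enorm (g u0) / r) * c ^+ 2); first by rewrite mulr_gt0 // exprn_gt0.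
move=> w; have -> : \sum_i \sum_k w 0 i * w 0 k * half_hess k i u0 =
    dotv (sff phi u0 w w) (g u0) + dotv (push phi u0 w) (push phi u0 w).
  rewrite exchange_big /= /sff dotv_suml [push _ _ _]push_partials // dotv_suml -big_split /=.
  apply: eq_bigr => k _; rewrite dotv_suml dotvZl dotv_sumr mulr_sumr -big_split /=.
  apply: eq_bigr => i _; rewrite dotvZl dotvZr /sff_coord dotvDl dotvNl dotv_suml.
  rewrite [X in _ - X]big1 ?subr0 /half_hess; last first.
    by move=> l _; rewrite dotvZl -/g -/(half_grad phi l u0) -/hg crit mulr0.
  by rewrite (dotvC (partial i g u0)) mulrDr !mulrA (mulrC (w 0 i) (w 0 k)).
have P0 := dotv_ge0 (push phi u0 w); set P := dotv (push _ _ _) _ in P0 *.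
have sb : enorm (sff phi u0 w w) <= r^-1 * P.
  apply: sff_bound => //; last by rewrite invr_ge0 ltW.
  by move=> e /hA; rewrite div1r exprVn.
have h1 : - (enorm (g u0) / r * P) <= dotv (sff phi u0 w w) (g u0).
  rewrite lerNl; apply: le_trans (ler_norm _) _; rewrite normrN.
  apply: le_trans (dotv_le_enorm _ _) _.
  apply: le_trans (ler_wpM2r (enorm_ge0 _) sb) _.
  by rewrite le_eqVlt; apply/orP; left; apply/eqP; ring.
have h2 : c ^+ 2 * `|w| ^+ 2 <= P.
  apply: le_trans (norm_sqr_le_dotv _); rewrite -exprMn.
  by rewrite ler_sqr ?nnegrE ?mulr_ge0 ?(ltW c0) //; exact: cJ.
have := ler_wpM2l (ltW lam0) h2; rewrite mulrA; lra.
Qed.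

End ChartHessian.

(** * The disk around a nondegenerate minimum *)

Section ChartCentre.
Context {R : realType} {n : nat} {S : topologicalType}.
Variables (x : S -> 'rV[R]_n) (phi : chart x) (u0 : 'rV[R]_2).
Hypotheses (hS : hausdorff_space S) (csq : continuous (sqnorm x)).

Let g := ext phi.
Let dom u := (cdom phi `&` half_plane) u.
Let psi u := dotv (g u) (g u).
Let co := Defs.coord phi.

Hypothesis du0 : dom u0.

(** A closed sublevel set of a function growing along the rays from [u0] is
    star-shaped.  Keeping the direction of [u - u0] and using the increment of the
    function as the new radius maps it to the unit disk. *)
Section Growth.
Variables (rho kappa : R).
Hypotheses (rho0 : 0 < rho) (kappa0 : 0 < kappa).
Hypothesis ball_dom : forall u, `|u - u0| < rho -> dom u.
Hypothesis growth : forall u (t : R), `|u - u0| < rho -> u != u0 -> 0 <= t < 1 ->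
  kappa * (t * (1 - t) * `|u - u0| ^+ 2) < psi u - psi (u0 + t *: (u - u0)).

(* By growth from the midpoint of the ray, [psi] exceeds [psi u0 + h] outside the
   ball of radius [rho / 2]. *)
Let h := kappa * rho ^+ 2 / 16.
Let q := par phi u0.
Let D : set S := [set s | crng phi s /\ `|co s - u0| < rho].
Let K : set S := D `&` [set s | sqnorm x s <= sqnorm x q + h].

Let h0 : 0 < h. Proof. by rewrite divr_gt0 // mulr_gt0 // exprn_gt0. Qed.

Let psi_co s : crng phi s -> sqnorm x s = psi (co s).
Proof. by move=> rs; have [ds ps] := coordP rs; rewrite /psi sqext_sqnorm // ps. Qed.

Let psi_q : sqnorm x q = psi u0.
Proof. by rewrite /psi sqext_sqnorm. Qed.

Let psi_gt u : `|u - u0| < rho -> u != u0 -> psi u0 < psi u.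
Proof.
move=> ur uu0; have := @growth u 0 ur uu0; rewrite lexx ltr01 => /(_ isT).
by rewrite mul0r mul0r mulr0 scale0r addr0 subr_gt0.
Qed.

Let psi_far u : rho / 2 <= `|u - u0| < rho -> psi u0 + h < psi u.
Proof.
move=> /andP[u2 ur]; have uu0 : u != u0.
  by rewrite -subr_eq0 -normr_gt0; apply: lt_le_trans u2; rewrite divr_gt0.
have t01 : 0 <= (2^-1 : R) < 1 by lra.
have := growth ur uu0 t01; set m := u0 + _ => hm.
have mr : `|m - u0| < rho.
  rewrite /m addrC addKr normrZ ger0_norm; last by lra.
  by have := normr_ge0 (u - u0); lra.
have mu0 : m != u0.
  by rewrite -subr_eq0 /m addrC addKr scaler_eq0 subr_eq0 negb_or uu0 andbT; lra.
have := psi_gt mr mu0.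
have : (rho / 2) ^+ 2 <= `|u - u0| ^+ 2.
  by rewrite ler_sqr ?nnegrE // divr_ge0 // ltW.
rewrite -(ler_pM2l kappa0) /h.
have -> : kappa * (rho / 2) ^+ 2 = 4 * (kappa * rho ^+ 2 / 16) by field.
move: hm; have -> : kappa * (2^-1 * (1 - 2^-1) * `|u - u0| ^+ 2) =
  kappa * `|u - u0| ^+ 2 / 4 by field.
lra.
Qed.

Let co_continuous s : crng phi s -> {for s, continuous co}.
Proof.
move=> rs W nW; have c := coord_near rs (nW : nbhs (co s) W).
exact: (filterS (fun s' (h : crng phi s' /\ W (co s')) => proj2 h) c).
Qed.

Let norm_ball_open : open [set u : 'rV[R]_2 | `|u - u0| < rho].
Proof.
have -> : [set u : 'rV[R]_2 | `|u - u0| < rho] = ball u0 rho.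
  by rewrite mx_norm_ball predeqE => u; rewrite /ball_ /= distrC.
exact: ball_open.
Qed.

Let D_open : open D.
Proof.
rewrite openE => s [rs sr]; rewrite /interior.
have nb : nbhs (co s) [set u : 'rV[R]_2 | `|u - u0| < rho] by exact: open_nbhs_nbhs.
exact: coord_near rs nb.
Qed.

Let Dq : D q.
Proof. by have [rq cq] := parP du0; split=> //; rewrite /co cq subrr normr0. Qed.

Let q_of_co s : crng phi s -> co s = u0 -> s = q.
Proof. by move=> rs cs; have [_ <-] := coordP rs; rewrite -/co cs. Qed.

Let K_close s : K s -> [/\ crng phi s, `|co s - u0| <= rho / 2 & sqnorm x s <= sqnorm x q + h].
Proof.
move=> [[rs sr] /= sh]; split=> //; rewrite leNgt; apply/negP => far.
have : psi u0 + h < psi (co s) by apply: psi_far; rewrite ltW.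
by rewrite -psi_q -psi_co // ltNge sh.
Qed.

Let half_rho : rho / 2 < rho. Proof. by rewrite ltr_pdivrMr // ltr_pMr // ltr1n. Qed.

Let K_compact : compact K.
Proof.
pose L : set 'rV[R]_2 := [set u | `|u - u0| <= rho / 2].
have cL : compact L.
  apply: bounded_closed_compact.
    exists (rho / 2 + `|u0|); split; first exact: num_real.
    move=> M ltM u /= Lu; apply: le_trans (ltW ltM).
    by rewrite -{1}(subrK u0 u); apply: le_trans (ler_normD _ _) _; rewrite lerD2r.
  have -> : L = (fun u => `|u - u0|) @^-1` [set t | t <= rho / 2] by [].
  apply: preimage_closed => [u _|]; last exact: closed_le.
  have c1 : {for u, continuous (fun u : 'rV[R]_2 => u - u0)}.
    exact: (cvgB cvg_id (cvg_cst u0)).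
  by apply: (continuous_comp c1); exact: norm_continuous.
have -> : K = (par phi @` L) `&` [set s | sqnorm x s <= sqnorm x q + h].
  rewrite predeqE => s; split=> [Ks|[[u Lu <-] sh]].
    have [rs sL sh] := K_close Ks; split=> //; exists (co s) => //.
    by have [] := coordP rs.
  have ur := le_lt_trans Lu half_rho; have [ru cu] := parP (ball_dom ur).
  by split=> //; split=> //; rewrite /co cu.
apply: compact_closedI; last exact: (sublevel_closed csq (fun=> cvg_cst _)).
apply: continuous_compact => //; case: (chart_homeo phi) => _ _ cp _.
apply: within_continuousS cp => u Lu; apply: ball_dom; exact: le_lt_trans Lu half_rho.
Qed.

(* At [s = q] the quotient [a s / enorm (w s)] is [0 / 0 = 0], and [f q = 0]. *)
Let a s := (sqnorm x s - sqnorm x q) / h.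
Let w s := co s - u0.
Let f s : 'rV[R]_2 := (a s / enorm (w s)) *: w s.

Let a_gt0 s : K s -> w s != 0 -> 0 < a s.
Proof.
move=> [[rs sr] _]; rewrite subr_eq0 => ws; rewrite divr_gt0 // subr_gt0 psi_q psi_co //.
exact: psi_gt.
Qed.

Let a_q s : K s -> w s = 0 -> a s = 0.
Proof.
move=> [[rs _] _] /eqP; rewrite subr_eq0 => /eqP ws.
by rewrite /a (q_of_co rs ws) subrr mul0r.
Qed.

Let a_ge0 s : K s -> 0 <= a s.
Proof. by move=> Ks; have [/(a_q Ks) ->|/(a_gt0 Ks)/ltW] := eqVneq (w s) 0. Qed.

Let a_le1 s : K s -> a s <= 1.
Proof. by move=> [_ /= sh]; rewrite ler_pdivrMr // mul1r lerBlDl. Qed.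

Let enorm_f s : K s -> enorm (f s) = a s.
Proof.
move=> Ks; have [w0|w0] := eqVneq (w s) 0.
  by rewrite /f w0 scaler0 (a_q Ks w0) /enorm dotv0l sqrtr0.
have e0 := enorm_gt0 w0.
have h1 : 0 <= a s / enorm (w s) by rewrite divr_ge0 ?enorm_ge0 // a_ge0.
by rewrite /f enormZ (ger0_norm h1) divfK // lt0r_neq0.
Qed.

Let a_mono s s' (c : R) : K s -> K s' -> w s != 0 -> 0 <= c < 1 -> w s' = c *: w s ->
  a s' < a s.
Proof.
move=> [[rs sr] _] [[rs' _] _] ws c01 ww.
rewrite ltr_pM2r ?invr_gt0 // ltrD2r !psi_co //.
have uu0 : co s != u0 by rewrite -subr_eq0.
have := growth sr uu0 c01.
have <- : co s' = u0 + c *: (co s - u0) by rewrite -/(w s) -ww /w addrC subrK.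
move=> lt; rewrite -subr_gt0; apply: le_lt_trans lt.
by case/andP: c01 => c0 c1; rewrite !mulr_ge0 ?sqr_ge0 ?subr_ge0 // ltW.
Qed.

Let f_inj s s' : K s -> K s' -> f s = f s' -> s = s'.
Proof.
move=> Ks Ks' ff; have aa : a s = a s' by rewrite -!enorm_f // ff.
have [[rs _] _] := Ks; have [[rs' _] _] := Ks'.
have [w0|w0] := eqVneq (w s) 0.
  have w0' : w s' = 0.
    apply/eqP; apply: contraT => /(a_gt0 Ks'); by rewrite -aa (a_q Ks w0) ltxx.
  rewrite (q_of_co rs); last by apply/eqP; rewrite -subr_eq0; exact/eqP.
  by rewrite (q_of_co rs') //; apply/eqP; rewrite -subr_eq0; exact/eqP.
have a0 := a_gt0 Ks w0.
have w0' : w s' != 0.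
  by apply: contraTneq a0 => /(a_q Ks'); rewrite aa => ->; rewrite ltxx.
have e0 := enorm_gt0 w0; have e0' := enorm_gt0 w0'.
have ww : w s' = (enorm (w s') / enorm (w s)) *: w s.
  have := congr1 (fun v => (enorm (w s') / a s) *: v) ff.
  rewrite /f -aa !scalerA => E; rewrite -[LHS]scale1r.
  have -> : 1 = enorm (w s') / a s * (a s / enorm (w s')) :> R.
    by field; rewrite !lt0r_neq0.
  by rewrite -E; congr (_ *: _); field; rewrite !lt0r_neq0.
have [lt|lt|e] := ltgtP (enorm (w s') / enorm (w s)) 1.
- have := a_mono Ks Ks' w0 _ ww; rewrite lt divr_ge0 ?enorm_ge0 // => /(_ isT).
  by rewrite aa ltxx.
- have ww' : w s = (enorm (w s') / enorm (w s))^-1 *: w s'.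
    by rewrite {2}ww scalerA mulVf ?scale1r // lt0r_neq0 // divr_gt0.
  have := a_mono Ks' Ks w0' _ ww'; rewrite invr_ge0 divr_ge0 ?enorm_ge0 //=.
  by rewrite invf_lt1 ?divr_gt0 // lt aa ltxx => /(_ isT).
- have cc : co s' = co s by move: ww; rewrite e scale1r => /addIr.
  have [_ <-] := coordP rs; have [_ <-] := coordP rs'.
  by rewrite -/co cc.
Qed.

Let f_surj v : disk v -> exists2 s, K s & f s = v.
Proof.
move=> dv; have {}dv : enorm v <= 1 := dv.
have Kq : K q by split=> //=; rewrite lerDl ltW.
have wq : w q = 0 by have [_ cq] := parP du0; rewrite /w /co cq subrr.
have [->|v0] := eqVneq v 0; first by exists q => //; rewrite /f wq scaler0.
have e0 := enorm_gt0 v0; have nv0 : 0 < `|v| by rewrite normr_gt0.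
pose T := rho / 2 / `|v|; have T0 : 0 < T by rewrite !divr_gt0.
have inr (t : R) : 0 <= t <= T -> `|u0 + t *: v - u0| <= rho / 2.
  by move=> /andP[t0 tT]; rewrite addrC addKr normrZ ger0_norm // -ler_pdivlMr.
pose m (t : R) := psi (u0 + t *: v).
have cm : {within `[0, T], continuous m}.
  apply: continuous_in_subspaceT => t; rewrite inE /= in_itv /= => t0T.
  have [ct _] := ball_dom (le_lt_trans (inr t t0T) half_rho).
  have cg := ext_continuous ct.
  have cps : {for u0 + t *: v, continuous psi} by exact (dotv_continuous cg cg).
  apply: (@continuous_comp _ _ _ (fun t : R => u0 + t *: v) psi) cps.
  by apply: cvgD; [exact: cvg_cst | apply: cvgZr_tmp; exact: cvg_id].
have m0 : m 0 = psi u0 by rewrite /m scale0r addr0.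
have mT : psi u0 + h < m T.
  apply: psi_far; rewrite (_ : `|_ - u0| = rho / 2) ?lexx //.
  rewrite addrC addKr normrZ gtr0_norm // /T divfK //; exact: lt0r_neq0.
have vh : 0 < enorm v * h by rewrite mulr_gt0.
have vh1 : enorm v * h <= h by rewrite ler_piMl // ltW.
have [|t] := @IVT _ m 0 T (psi u0 + enorm v * h) (ltW T0) cm.
  rewrite ge_min le_max m0; apply/andP; split; apply/orP; [left | right]; lra.
rewrite in_itv /= => t0T mt.
have tr := inr t t0T; have dt := ball_dom (le_lt_trans tr half_rho).
have [rt ct] := parP dt.
have t0 : 0 < t.
  rewrite lt0r; apply/andP; split; last by case/andP: t0T.
  by apply: contraTneq vh => t0; move: mt; rewrite t0 m0 => E; rewrite -leNgt; lra.
have sqt : sqnorm x (par phi (u0 + t *: v)) = psi u0 + enorm v * h.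
  by rewrite -mt /m /psi sqext_sqnorm.
exists (par phi (u0 + t *: v)).
  split; last by rewrite /= sqt psi_q lerD2l.
  by split=> //; rewrite /co ct; exact: le_lt_trans tr half_rho.
rewrite /f /w /a /co ct sqt psi_q [u0 + _ - u0]addrC addKr enormZ gtr0_norm //.
have -> : psi u0 + enorm v * h - psi u0 = enorm v * h by ring.
rewrite scalerA -[RHS]scale1r; congr (_ *: _); field.
by rewrite !lt0r_neq0.
Qed.

Let f_continuous : {within K, continuous f}.
Proof.
apply/within_continuousP => s Ks W nW; have [[rs _] _] := Ks.
have ca : {for s, continuous a}.
  have c1 : {for s, continuous (fun s => sqnorm x s - sqnorm x q)}.
    by apply: cvgB; [exact: csq | exact: cvg_cst].
  exact: (cvgM c1 (cvg_cst h^-1)).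
have cw : {for s, continuous w} by exact: (cvgB (co_continuous rs) (cvg_cst u0)).
have [w0|w0] := eqVneq (w s) 0.
  have [e e0 eW] := nbhs_row_ball nW.
  have na : \forall s' \near s, `|a s - a s'| < e by exact: cvgr_dist_lt ca e e0.
  apply: filterS na => s' h' Ks'; apply: eW.
  rewrite {2}/f w0 scaler0 subr0; apply: le_lt_trans (norm_le_enorm _) _.
  rewrite enorm_f //; move: h'; rewrite (a_q Ks w0) sub0r normrN ger0_norm //.
  exact: a_ge0.
have ce : {for s, continuous (fun s => enorm (w s))}.
  by apply: (continuous_comp cw); exact: enorm_continuous.
have ce1 : {for s, continuous (fun s => a s / enorm (w s))}.
  apply: (cvgM ca); apply: cvgV ce; exact: lt0r_neq0 (enorm_gt0 w0).
have cf : {for s, continuous f} by exact: (cvgZ ce1 cw).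
have nf : nbhs s (f @^-1` W) by exact: cf.
by apply: filterS nf => s' Ws' _.
Qed.

Lemma growth_centre : centre (sqnorm x) q.
Proof.
exists D, (sqnorm x q + h); split.
  split=> //; first by rewrite ltrDl.
  rewrite predeqE => s; split=> [[[rs sr] /= sq]|->]; last by split=> //=.
  apply: q_of_co => //; apply/eqP; apply: contraT => cs.
  by have := psi_gt sr cs; rewrite -psi_co // -psi_q ltNge sq.
split; first exact: compact_closed K_compact.
apply: (@homeomorphic_of_inj _ _ K disk f q) => //.
by move=> s Ks; rewrite /disk /closed_eball /= enorm_f //; exact: a_le1.
Qed.

End Growth.

Lemma chart_centre (kappa : R) : 0 < u0 0 1 -> (forall i, half_grad phi i u0 = 0) ->
  0 < kappa ->
  (forall w : 'rV[R]_2,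
     kappa * `|w| ^+ 2 <= \sum_i \sum_k w 0 i * w 0 k * half_hess phi k i u0) ->
  centre (sqnorm x) (par phi u0).
Proof.
move=> u01 crit k0 hess.
have [r1 r10 P1] := convex_near_critical du0 crit k0 hess.
have [r2 r20 P2] : exists2 r2 : R, 0 < r2 & forall u : 'rV[R]_2, `|u - u0| < r2 ->
    cdom phi u /\ 0 < u 0 1.
  apply: nbhs_row_ball.
  have n1 : \forall u \near u0, cdom phi u.
    by apply: open_nbhs_nbhs; split; [exact: (@cdom_open _ _ _ _ phi) | case: du0].
  have n2 : nbhs u0 [set u : 'rV[R]_2 | 0 < u 0 1].
    apply: (@coord_continuous R 1 2 0 1 u0 [set t | 0 < t]); exact: lt_nbhsr.
  by apply: filterS2 n1 n2 => u ? ?; split.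
have r0 : 0 < Num.min r1 r2 by rewrite lt_min r10.
have bd u : `|u - u0| < Num.min r1 r2 -> dom u.
  by rewrite lt_min => /andP[_ /P2[cu u1]]; split=> //; exact: ltW.
apply: (growth_centre r0 k0 bd).
apply: (radial_growth (d := fun i w => 2 * half_grad phi i w) (f := psi)) => //.
- move=> w /bd [cw _]; exact: sqext_differentiable.
- by move=> w; rewrite lt_min => /andP[/P1].
Qed.

End ChartCentre.

(** * The free boundary and the conclusion *)

Section FreeBoundary.
Context {R : realType} {n : nat} {S : topologicalType}.
Variables (x : S -> 'rV[R]_n) (r : R).
Hypotheses (r0 : 0 < r) (ball : range x `<=` closed_eball r).
Hypothesis free : free_boundary r x.

Lemma sqnorm_le s : sqnorm x s <= r ^+ 2.
Proof.
have xr : enorm (x s) <= r by apply: ball; exists s.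
by rewrite /sqnorm -enorm_sqr ler_sqr ?nnegrE ?enorm_ge0 // ltW.
Qed.

Lemma sqnorm_bdry s : bdry x s -> sqnorm x s = r ^+ 2.
Proof.
have [sph _ _] := free => bs; rewrite /sqnorm -enorm_sqr.
by have -> : enorm (x s) = r by apply: sph; exists s.
Qed.

Section BoundaryPoint.
Variables (phi : chart x) (u0 : 'rV[R]_2).
Hypotheses (du0 : (cdom phi `&` half_plane) u0) (u01 : u0 0 1 = 0).

Let g := ext phi.
Let hg i := half_grad phi i u0.

Let bdry_u0 : bdry x (par phi u0).
Proof. by have [ru cu] := parP du0; exists phi; rewrite cu. Qed.

(** At the boundary [|x|^2] is [r^2], its largest possible value. *)
Lemma inward_slope_le0 (v : 'rV[R]_2) : 0 <= v 0 1 -> \sum_i v 0 i * hg i <= 0.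
Proof.
move=> v1; rewrite leNgt; apply/negP => pos; have [cu0 _] := du0.
have [rho rho0 inc] := increase_along cu0 pos.
have [rho2 r20 P2] := nbhs_row_ball
  (open_nbhs_nbhs (conj (@cdom_open _ _ _ _ phi) cu0)).
pose t := Num.min (rho / 2) (rho2 / 2 / (`|v| + 1)).
have v0 : 0 < `|v| + 1 by rewrite ltr_wpDl.
have t0 : 0 < t by rewrite lt_min !divr_gt0.
have tr : t <= rho / 2 by rewrite ge_min lexx.
have tr2 : t <= rho2 / 2 / (`|v| + 1) by rewrite ge_min lexx orbT.
have dt : (cdom phi `&` half_plane) (u0 + t *: v).
  split; last by rewrite /half_plane /= !mxE u01 add0r mulr_ge0 // ltW.
  apply: P2; rewrite addrC addKr normrZ gtr0_norm //.
  apply: (@le_lt_trans _ _ (t * (`|v| + 1))); first by rewrite ler_wpM2l ?(ltW t0) // lerDl.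
  by move: tr2; rewrite ler_pdivlMr //; lra.
have := inc t; rewrite t0 (le_lt_trans tr) /=; last by lra.
move=> /(_ isT); rewrite (sqext_sqnorm du0) (sqext_sqnorm dt) (sqnorm_bdry bdry_u0).
by rewrite ltNge sqnorm_le.
Qed.

(** Both directions of the boundary curve point weakly inwards, so the tangential slope
    vanishes.  If the normal slope vanished as well, [x] would be orthogonal to the
    surface, and the orthogonality condition, tested on the conormal itself, would
    make the conormal zero. *)
Lemma boundary_slope : hg 0 = 0 /\ hg 1 < 0.
Proof.
have [cu0 _] := du0.
have slope v : \sum_i v 0 i * hg i = v 0 0 * hg 0 + v 0 1 * hg 1.
  exact: sum_ord2.
have h0 : hg 0 = 0.
  pose v (a : R) : 'rV[R]_2 := a *: delta_mx 0 0.
  have s0 a : a * hg 0 <= 0.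
    have := @inward_slope_le0 (v a); rewrite slope !mxE /= mulr0 mulr1 mul0r addr0.
    exact.
  by apply/eqP; rewrite -sqrf_eq0 eq_le sqr_ge0 expr2 s0.
split=> //; have h1 : hg 1 <= 0.
  have := @inward_slope_le0 (delta_mx 0 1); rewrite slope !mxE /= h0 mulr0 add0r mul1r.
  exact.
rewrite lt_neqAle h1 andbT; apply/eqP => h10.
have e0 : delta_mx 0 0 != 0 :> 'rV[R]_2.
  by apply/eqP => /matrixP/(_ 0 0); rewrite !mxE !eqxx => /eqP; rewrite oner_eq0.
have [eta eta0 eta_conormal] := orthogonal_direction du0 e0.
have [_ _ orth] := free.
pose X := x (par phi u0); pose P := push phi u0 eta.
have XX : dotv X X = r ^+ 2 by exact: sqnorm_bdry bdry_u0.
have PX : dotv P X = 0.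
  by rewrite /X -extE // push_half_grad // slope -!/(hg _) h0 h10 !mulr0 addr0.
have := orth phi u0 du0 u01 eta eta_conormal P PX.
by apply/eqP; rewrite gt_eqF //; exact: push_dotv_gt0.
Qed.

End BoundaryPoint.

Hypotheses (hS : hausdorff_space S) (charts : forall s : S, exists phi : chart x, crng phi s).

Lemma position_continuous : continuous x.
Proof.
move=> s W nW; have [phi rs] := charts s; have [dc pc] := coordP rs.
have [cc _] := dc.
have nW' : nbhs (ext phi (Defs.coord phi s)) W by rewrite extE // pc.
have nV : nbhs (Defs.coord phi s) (ext phi @^-1` W) by exact: ext_continuous.
have nc := coord_near rs nV.
have : nbhs s (x @^-1` W).
  apply: filterS nc => s' [rs' h]; have [dc' pc'] := coordP rs'.
  by have := h; rewrite /preimage /= extE // pc'.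
by [].
Qed.

Lemma sqnorm_continuous : continuous (sqnorm x).
Proof. by move=> s; exact (dotv_continuous (@position_continuous s) (@position_continuous s)). Qed.

Lemma noncritical_boxed (phi : chart x) s i : crng phi s ->
  half_grad phi i (Defs.coord phi s) != 0 -> boxed x (sqnorm x) s.
Proof.
move=> rs hi; have [dc pc] := coordP rs; have [cc hp] := dc.
rewrite -pc; have [u1|u1] := eqVneq (Defs.coord phi s 0 1) 0.
  have [_ h1] := boundary_slope dc u1.
  apply: (@chart_boxed _ _ _ _ _ _ 0 1 (-1)) => //; first by rewrite sqrrN expr1n.
    by rewrite mulN1r oppr_gt0.
  by right.
have u10 : 0 < Defs.coord phi s 0 1 by rewrite lt0r u1.
pose sg : R := Num.sg (half_grad phi i (Defs.coord phi s)).
apply: (@chart_boxed _ _ _ _ _ _ (if i == 0 then 1 else 0) i sg) => //.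
- by case: (ord2_cases i (isT : (0 : 'I_2) != 1)) => ->.
- by rewrite sqr_sg hi.
- by rewrite -normrEsg normr_gt0.
- by left.
Qed.

(** A point that is critical in every chart is not a boundary point, by
    [boundary_slope]; hence [|x| < r] there and the Hessian is definite. *)
Lemma boxed_or_centre : sff_normsq_le x (1 / r ^+ 2) ->
  forall s, boxed x (sqnorm x) s \/ centre (sqnorm x) s.
Proof.
move=> hA s.
have [[phi [rs [i hi]]]|crit] := pselect (exists phi : chart x,
    crng phi s /\ exists i, half_grad phi i (Defs.coord phi s) != 0).
  by left; exact: noncritical_boxed rs hi.
have {}crit (phi : chart x) i : crng phi s -> half_grad phi i (Defs.coord phi s) = 0.
  move=> rs; apply/eqP; apply: contraT => hi; exfalso; apply: crit.
  by exists phi; split=> //; exists i.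
have inner (phi : chart x) : crng phi s -> 0 < Defs.coord phi s 0 1.
  move=> rs; have [dc _] := coordP rs; have [_ hp] := dc.
  rewrite lt0r; apply/andP; split=> //; apply/eqP => u1.
  by have [_] := boundary_slope dc u1; rewrite crit // ltxx.
have nbd : ~ bdry x s by move=> [phi [rs u1]]; have := inner phi rs; rewrite u1 ltxx.
have [_ int _] := free; have xr : enorm (x s) < r by apply: int; exists s.
right; have [phi rs] := charts s; have [dc pc] := coordP rs.
have gr : enorm (ext phi (Defs.coord phi s)) < r by rewrite extE // pc.
have [kappa k0 hess] := half_hess_lower_bound dc r0 (fun i => crit phi i rs) gr
  (fun e => hA phi _ e dc).
rewrite -pc; apply: (chart_centre hS sqnorm_continuous dc (inner phi rs) _ k0 hess).
by move=> i; exact: crit.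
Qed.

End FreeBoundary.

Theorem corollary1p3 (R : realType) (k : nat) (r c : R)
    (S : topologicalType) (x : S -> 'rV[R]_(2 + k))
    (hr : 0 < r) (hc : 0 <= c) (hk : (1 <= k)%N)
    (hsurf : smooth_surface x)
    (hball : range x `<=` closed_eball r)
    (hcompact : compact [set: S])
    (hconn : connected [set: S])
    (horient : orientable x)
    (hfree : free_boundary r x)
    (hmin : f_minimal (fun y => c / 2 * enorm y ^+ 2) x)
    (hbdry : bdry x !=set0)
    (hA : sff_normsq_le x (1 / r ^+ 2)) :
  homeomorphic [set: S] (closed_eball 1 : set 'rV[R]_2).
Proof.
have [hS charts] := hsurf.
apply: (sublevel_disk hS hcompact (position_continuous charts)
  (sqnorm_continuous charts) (boxed_or_centre hr hball hfree hS charts hA) hconn).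
by have [s _] := hbdry; exists s.
Qed.
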